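(* Let $R$ be a commutative (associative) ring with unity such that the maximal ideal space of $R$ is a noetherian space of dimension $\le d$. Then the fundamental group $\pi_1(\mathrm{EUm}_n(R))$ at the base point $e=(1,0,\ldots,0)$ is trivial for all $n\ge d+3$.
   Context: For $i\neq j$, $r\in R$, $E_{ij}(r)=I_n+re_{ij}$; $\mathrm E_n(R)\subseteq\mathrm{GL}_n(R)$ is generated by these. $J_n=\{(i,j):1\le i,j\le n,i\ne j\}$; $\alpha\subseteq J_n$ is nilpotent if $(i,j)\in\alpha\Rightarrow(j,i)\notin\alpha$ and $(i,j),(j,k)\in\alpha\Rightarrow(i,k)\in\alpha$; $\Phi_n$ is the set of nilpotent subsets; $\mathrm E_n(R)_\alpha$ is the subgroup generated by the $E_{ij}(r)$ with $(i,j)\in\alpha$, $r\in R$. $\mathrm{EUm}_n(R)$ is the orbit $e\,\mathrm E_n(R)$ of $e=(1,0,\ldots,0)$ under right multiplication (identified with the space of right cosets $\mathrm{E}_n(R)/\mathrm{EP}_n(R)$, where $\mathrm{EP}_n(R)$ is the stabilizer of $e$ in $\mathrm E_n(R)$), viewed as a single domain global action: the local groups $\mathrm E_n(R)_\alpha$, $\alpha\in\Phi_n$, act on the whole set by right multiplication. A local frame is a nonempty finite subset contained in a single orbit of a single local group. A path is a map $\omega:\mathbb Z\to\mathrm{EUm}_n(R)$ with each $\{\omega(m),\omega(m+1)\}$ a local frame, constant for $m\ll0$ (initial point) and constant for $m\gg0$ (terminal point). Paths $\omega,\omega'$ are stably homotopic if there is $H:\mathbb Z\times\mathbb Z\to\mathrm{EUm}_n(R)$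 sending each unit square $\{m,m+1\}\times\{k,k+1\}$ to a local frame, with each $H(\cdot,k)$ a path whose initial and terminal points are independent of $k$, and $H(\cdot,k)=\omega$ for $k\ll0$, $H(\cdot,k)=\omega'$ for $k\gg0$. $\pi_1(\mathrm{EUm}_n(R))$ is the group of stable homotopy classes of paths with initial and terminal point both equal to $e$, under concatenation. *)

(* Defs.v *)
From HB Require Import structures.
From mathcomp Require Import all_boot all_order all_algebra.
From mathcomp Require Import zify.
From mathcomp Require Import all_classical topology_structure.

Set Implicit Arguments.
Unset Strict Implicit.
Unset Printing Implicit Defensive.

Import Order.TTheory GRing.Theory Num.Theory.

Local Open Scope classical_set_scope.
Local Open Scope ring_scope.
Local Open Scope quotient_scope.

Definition noetherian_space (T : topologicalType) : Prop :=
  forall F : nat -> set T,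
    (forall i, closed (F i)) -> (forall i, F i.+1 `<=` F i) ->
    exists N, forall i, (N <= i)%N -> F i = F N.

Definition irreducible_set (T : topologicalType) (A : set T) : Prop :=
  A !=set0 /\
  forall B C : set T, closed B -> closed C ->
    A `<=` B `|` C -> A `<=` B \/ A `<=` C.

(* The empty space has dimension at most [d] for every [d]. *)
Definition krull_dim_le (T : topologicalType) (d : nat) : Prop :=
  forall (k : nat) (Z : nat -> set T),
    (forall i, (i <= k)%N -> closed (Z i) /\ irreducible_set (Z i)) ->
    (forall i, (i < k)%N -> Z i `<` Z i.+1) ->
    (k <= d)%N.

(* The ideals of ring_quotient are boolean predicates over nontrivial rings;
   here [R] may be the zero ring, whose maximal ideal space is empty. *)
Definition ideal (R : comPzRingType) (I : set R) : Prop :=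
  [/\ I 0, forall x y, I x -> I y -> I (x + y)
    & forall a x, I x -> I (a * x)].

Definition maximal_ideal (R : comPzRingType) (I : set R) : Prop :=
  [/\ ideal I, I != setT
    & forall J, ideal J -> I `<=` J -> J = I \/ J = setT].

Lemma maximal_ideal_prime (R : comPzRingType) (I : set R) a b :
  maximal_ideal I -> I (a * b) -> I a \/ I b.
Proof.
move=> [[I0 ID IM] /eqP IT Imax] Iab.
pose J := [set x | exists y r, I y /\ x = y + r * a].
have JI : ideal J.
  split=> [|x y [u [r [Iu ->]]] [v [s [Iv ->]]]|c x [u [r [Iu ->]]]].
  - by exists 0, 0; rewrite mul0r addr0.
  - by exists (u + v), (r + s); split; [exact: ID|rewrite mulrDl addrACA].
  - by exists (c * u), (c * r); split; [exact: IM|rewrite mulrDr mulrA].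
have IJ : I `<=` J by move=> x Ix; exists x, 0; rewrite mul0r addr0.
case: (Imax J JI IJ) => JE.
  left; rewrite -JE; exists 0, 1; by rewrite mul1r add0r.
right; have [y [r [Iy E1]]] : J 1 by rewrite JE.
rewrite -[b]mul1r E1 mulrDl; apply: ID; first by rewrite mulrC; exact: IM.
by rewrite -mulrA; exact: IM.
Qed.

Definition max_spec (R : comPzRingType) : Type :=
  {I : set R | maximal_ideal I}.

Definition zero_locus (R : comPzRingType) (S : set R) : set (max_spec R) :=
  [set m | S `<=` sval m].

Section Zariski.
Variable R : comPzRingType.

HB.instance Definition _ := gen_eqMixin (max_spec R).
HB.instance Definition _ := gen_choiceMixin (max_spec R).

Definition zariski_open : set_system (max_spec R) :=
  [set U | exists S, ~` U = zero_locus S].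

Lemma zariski_openT : zariski_open setT.
Proof.
exists setT; rewrite setCT; apply/seteqP; split=> // m /= mT.
have [_ /eqP mN _] := svalP m; apply: mN.
by apply/seteqP; split.
Qed.

Lemma zariski_openI : setI_closed zariski_open.
Proof.
move=> U V [S US] [T VT]; exists [set x | exists a b, S a /\ T b /\ x = a * b].
rewrite setCI US VT; apply/seteqP; split=> [m|m /= mST].
- have [[_ _ mM] _ _] := svalP m.
  case=> mS _ [a [b [Sa [Tb ->]]]].
  + by rewrite mulrC; apply: mM; exact: mS.
  + by apply: mM; exact: mS.
- have [mS|/existsNP[a /not_implyP[Sa ma]]] := pselect (S `<=` sval m).
    by left.
  right=> b Tb; have : sval m (a * b) by apply: mST; exists a, b.
  by case/(maximal_ideal_prime (svalP m)).
Qed.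

Lemma zariski_open_bigU (J : Type) (f : J -> set (max_spec R)) :
  (forall i, zariski_open (f i)) -> zariski_open (\bigcup_i f i).
Proof.
move=> /choice[S fS]; exists (\bigcup_i S i); rewrite setC_bigcup.
apply/seteqP; split=> m /= mS.
- by move=> x [i _ Six]; have := mS i I; rewrite fS; apply.
- by move=> i _; rewrite fS => x Six; apply: mS; exists i.
Qed.

HB.instance Definition _ := isOpenTopological.Build (max_spec R)
  zariski_openT zariski_openI zariski_open_bigU.

End Zariski.

(* All that paths and stable homotopy use of a single domain global action is
   the collection of its local frames, which is closed under nonempty subsets
   and contains the singletons. *)
Record frame_space := FrameSpace {
  frame_point :> Type;
  frame : set frame_point -> Prop;
  frame1 : forall x, frame [set x];
  frame_sub : forall A B, A !=set0 -> A `<=` B -> frame B -> frame A }.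

Section Paths.
Variable X : frame_space.
Implicit Types (w : int -> X) (x y : X).

Definition initially w x : Prop := exists N : int, forall m : int, m <= N -> w m = x.

Definition finally w x : Prop := exists N : int, forall m : int, N <= m -> w m = x.

Definition is_path x y w : Prop :=
  [/\ forall m : int, frame [set w m; w (m + 1)], initially w x & finally w y].

Definition stably_homotopic w w' : Prop :=
  exists (H : int -> int -> X) (x y : X),
    [/\ forall m k : int, frame [set H m k; H (m + 1) k; H m (k + 1);
                               H (m + 1) (k + 1)],
        forall k : int, is_path x y (H ^~ k),
        exists K : int, forall k : int, k <= K -> H ^~ k = w
      & exists K : int, forall k : int, K <= k -> H ^~ k = w'].

(* [w] up to its terminal point, reached by time [N], followed by [w'] from its
   initial point, which it leaves no earlier than time [N']. *)
Definition concat w w' (N N' : int) : int -> X :=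
  fun m => if m <= N then w m else w' (m - N + N').

Definition revpath w : int -> X := fun m => w (- m).

End Paths.

Record loop (X : frame_space) (x : X) := Loop {
  loop_fun :> int -> X;
  loopP : is_path x x loop_fun }.

Section HomotopyTheory.
Variables (X : frame_space) (x : X).
Implicit Types (w : int -> X) (a b c : loop x).

Local Notation hom := (@stably_homotopic X).
Local Notation lp := (is_path x x).

Lemma frame_le (A B : set X) : frame B -> A !=set0 -> A `<=` B -> frame A.
Proof. by move=> fB A0 AB; exact: frame_sub A0 AB fB. Qed.

Lemma initiallyU w y z : initially w y -> initially w z -> y = z.
Proof.
move=> [N wN] [M wM]; rewrite -(wN (Num.min N M)) ?wM //; lia.
Qed.

Lemma finallyU w y z : finally w y -> finally w z -> y = z.
Proof.
move=> [N wN] [M wM]; rewrite -(wN (Num.max N M)) ?wM //; lia.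
Qed.

(* An introduction rule in which the end points have uniform bounds. *)
Lemma homI w w' (H : int -> int -> X) (N N' K K' : int) :
  (forall m k : int, frame [set H m k; H (m + 1) k; H m (k + 1);
                          H (m + 1) (k + 1)]) ->
  (forall m k : int, m <= N -> H m k = x) ->
  (forall m k : int, N' <= m -> H m k = x) ->
  (forall m k : int, k <= K -> H m k = w m) ->
  (forall m k : int, K' <= k -> H m k = w' m) ->
  hom w w'.
Proof.
move=> Hf HN HN' HK HK'; exists H, x, x; split=> //.
- move=> k; split; [|by exists N => m ?; exact: HN|by exists N' => m ?; exact: HN'].
  move=> m; apply: (frame_le (Hf m k)); first by exists (H m k); left.
  by move=> z [->|->]; [left; left; left|left; left; right].
- by exists K => k kK; apply/funext => m; exact: HK.
- by exists K' => k kK; apply/funext => m; exact: HK'.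
Qed.

Lemma int_squeeze (K K' : int) (P : int -> int -> Prop) :
  (forall k : int, exists N, P k N) ->
  (forall k N M : int, M <= N -> P k N -> P k M) ->
  exists N : int, forall k : int, K <= k -> k <= K' -> P k N.
Proof.
move=> /choice[f Pf] Pmono.
have [n nE] : exists n : nat, K' - K <= n%:Z by exists `|K' - K|%N; lia.
suff [N NP] : exists N : int, forall k : int, K <= k -> k <= K + n%:Z -> P k N.
  by exists N => k Kk kK; apply: NP => //; lia.
elim: n {nE} => [|n [N NP]].
  exists (f K) => k ? ?; suff -> : k = K by []; lia.
exists (Num.min N (f (K + n.+1%:Z))) => k Kk kn.
have [kn'|kn'] : k <= K + n%:Z \/ k = K + n.+1%:Z by lia.
  by apply: Pmono (NP k Kk kn'); lia.
by rewrite kn'; apply: Pmono (Pf _); lia.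
Qed.

Lemma homE w w' : lp w -> hom w w' ->
  exists (H : int -> int -> X) (N N' K K' : int),
  [/\ forall m k : int, frame [set H m k; H (m + 1) k; H m (k + 1);
                          H (m + 1) (k + 1)],
  forall m k : int, m <= N -> H m k = x,
  forall m k : int, N' <= m -> H m k = x,
  forall m k : int, k <= K -> H m k = w m &
  forall m k : int, K' <= k -> H m k = w' m].
Proof.
move=> [_ wi wf] [H [u [v [Hf Hp [K HK] [K' HK']]]]].
have ux : u = x.
  by have [_ + _] := Hp K; rewrite HK // => wu; exact: initiallyU wu wi.
have vx : v = x.
  by have [_ _ +] := Hp K; rewrite HK // => wv; exact: finallyU wv wf.
rewrite {u}ux {v}vx in Hp.
have Hk k : H ^~ k = H ^~ (Num.max K (Num.min k (Num.max K K'))).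
  have [kK|kK] := leP k K; first by rewrite !HK //; lia.
  have [kK'|kK'] := leP k K'; last by rewrite !HK' //; lia.
  by congr (fun k => H ^~ k); lia.
have [N NP] : exists N : int, forall k : int, K <= k -> k <= Num.max K K' ->
    forall m : int, m <= N -> H m k = x.
  apply: int_squeeze => [k|k N M MN NP m mM]; first by have [] := Hp k.
  by apply: NP; lia.
have [N' NP'] : exists N : int, forall k : int, K <= k -> k <= Num.max K K' ->
    forall m : int, - N <= m -> H m k = x.
  apply: int_squeeze => [k|k M L LM NP' m mM]; last by apply: NP'; lia.
  have [_ _ [M HM]] := Hp k; exists (- M) => m mM; apply: HM; lia.
exists H, N, (- N'), K, K'; split=> //.
- move=> m k mN; have := congr1 (@^~ m) (Hk k) => /= ->.
  by apply: NP => //; lia.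
- move=> m k mN; have := congr1 (@^~ m) (Hk k) => /= ->.
  by apply: NP' => //; lia.
- by move=> m k kK; rewrite -(HK k).
- by move=> m k kK; rewrite -(HK' k).
Qed.

Lemma square_const w (m : int) : lp w ->
  frame [set w m; w (m + 1); w m; w (m + 1)].
Proof.
move=> [wf _ _]; apply: (frame_le (wf m)); first by exists (w m); do 3!left.
by move=> z [[[->|->]|->]|->]; [left|right|left|right].
Qed.

Lemma hom_refl w : lp w -> hom w w.
Proof.
move=> wp; have [_ [N wN] [N' wN']] := wp.
apply: (@homI _ _ (fun m _ => w m) N N' 0 0) => //.
- by move=> m _; exact: square_const.
- by move=> m _; exact: wN.
- by move=> m _; exact: wN'.
Qed.

Lemma hom_sym w w' : hom w w' -> hom w' w.
Proof.
move=> [H [u [v [Hf Hp [K HK] [K' HK']]]]].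
exists (fun m k => H m (- k)), u, v; split.
- move=> m k; apply: (frame_le (Hf m (- (k + 1)))).
    by exists (H m (- k)); do 3!left.
  rewrite (_ : - (k + 1) + 1 = - k); last by lia.
  move=> z [[[->|->]|->]|->]; [by left; right|by right|by do 3!left|].
  by do 2!left; right.
- by move=> k; exact: Hp.
- by exists (- K') => k kK; apply: HK'; lia.
- by exists (- K) => k kK; apply: HK; lia.
Qed.

Lemma hom_trans w w' w'' : hom w w' -> hom w' w'' -> hom w w''.
Proof.
move=> [H [u [v [Hf Hp [K HK] [K' HK']]]]] [G [s [t [Gf Gp [L GL] [L' GL']]]]].
have su : s = u.
  have [_ si _] := Gp L; have [_ ui _] := Hp K'.
  by rewrite GL // in si; rewrite HK' // in ui; exact: initiallyU si ui.
have tv : t = v.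
  have [_ _ tf] := Gp L; have [_ _ vf] := Hp K'.
  by rewrite GL // in tf; rewrite HK' // in vf; exact: finallyU tf vf.
rewrite {s}su {t}tv in Gp.
exists (fun m k => if k <= K' then H m k else G m (k - K' + L)), u, v; split.
- move=> m k; have [kK|kK] := leP k K'; have [kK1|kK1] := leP (k + 1) K'.
  + exact: Hf.
  + have -> : k = K' by lia.
    have e m' : H m' K' = G m' L.
      exact: (congr1 (@^~ m') (etrans (HK' K' (lexx _)) (esym (GL L (lexx _))))).
    by rewrite !e (_ : K' + 1 - K' + L = L + 1) ?Gf //; lia.
  + by exfalso; lia.
  + by rewrite (_ : k + 1 - K' + L = k - K' + L + 1) ?Gf //; lia.
- by move=> k; case: leP.
- exists (Num.min K K') => k kK; apply/funext => m.
  rewrite (_ : k <= K' = true); last by lia.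
  by rewrite -(HK k) //; lia.
- exists (Num.max (K' + 1) (L' + K' - L)) => k kK; apply/funext => m.
  rewrite (_ : k <= K' = false); last by lia.
  by rewrite -(GL' (k - K' + L)) //; lia.
Qed.

Definition ins (N : int) w : int -> X := fun m => if m <= N then w m else w (m - 1).

Lemma hom_ins_le w (N N' : int) : lp w -> N <= N' -> hom (ins N w) (ins N' w).
Proof.
move=> wp NN'; have [wf [L wL] [M wM]] := wp.
have edge (y z : X) m : (y = w m \/ y = w (m + 1)) -> (z = w m \/ z = w (m + 1)) ->
    forall y' z' : X, (y' = w m \/ y' = w (m + 1)) -> (z' = w m \/ z' = w (m + 1)) ->
    frame [set y; z; y'; z'].
  move=> yE zE y' z' y'E z'E; apply: (frame_le (wf m)); first by exists y; do 3!left.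
  by move=> _ [[[->|->]|->]|->]; [case: yE|case: zE|case: y'E|case: z'E] => ->;
     [left|right|left|right|left|right|left|right].
apply: (@homI _ _ (fun m k => ins (Num.max N (Num.min k N')) w m) L (M + 1) N N').
- move=> m k; rewrite /ins.
  set p := Num.max N (Num.min k N'); set q := Num.max N (Num.min (k + 1) N').
  have pq : q = p \/ q = p + 1 by lia.
  have E1 : (m + 1 - 1 = m)%R by lia.
  have E2 : (m - 1 + 1 = m)%R by lia.
  rewrite !E1.
  have [mp|mp] := leP m p.
    have -> : (m <= q) = true by lia.
    by apply: (edge _ _ m); [left|case: ifP => _; [right|left]|left|
      case: ifP => _; [right|left]].
  have -> : (m + 1 <= p) = false by lia.
  have [mq|mq] := leP m q.
    have -> : (m + 1 <= q) = false by lia.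
    by apply: (edge _ _ (m - 1)); rewrite E2; [left|right|right|right].
  have -> : (m + 1 <= q) = false by lia.
  by apply: (edge _ _ (m - 1)); rewrite E2; [left|right|left|right].
- by move=> m k mL; rewrite /ins; case: ifP => _; apply: wL; lia.
- by move=> m k mL; rewrite /ins; case: ifP => _; apply: wM; lia.
- by move=> m k kN; congr ins; lia.
- by move=> m k kN; congr ins; lia.
Qed.

Lemma hom_ins w (N : int) : lp w -> hom w (ins N w).
Proof.
move=> wp; have [_ _ [M wM]] := wp.
have {1}-> : w = ins (Num.max N M) w.
  apply/funext => m; rewrite /ins; case: leP => // mM.
  by rewrite !wM //; lia.
by apply: hom_sym; apply: hom_ins_le => //; lia.
Qed.

Lemma concat_path w w' (N N' : int) : lp w -> lp w' ->
  (forall m : int, N <= m -> w m = x) -> (forall m : int, m <= N' -> w' m = x) ->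
  lp (concat w w' N N').
Proof.
move=> [wf [L wL] _] [wf' _ [M wM]] wN wN'; split.
- move=> m; rewrite /concat; have [mN|mN] := leP m N.
    have [mN1|mN1] := leP (m + 1) N; first exact: wf.
    have -> : m = N by lia.
    rewrite wN // -(wN' N') // (_ : N + 1 - N + N' = N' + 1) ?wf' //; lia.
  have -> : (m + 1 <= N) = false by lia.
  by rewrite (_ : m + 1 - N + N' = m - N + N' + 1) ?wf' //; lia.
- exists (Num.min L N) => m mL; rewrite /concat.
  by rewrite (_ : m <= N = true) ?wL //; lia.
- exists (Num.max (N + 1) (M + N - N')) => m mL; rewrite /concat.
  by rewrite (_ : m <= N = false) ?wM //; lia.
Qed.

Lemma concat_indepr w w' (N N' : int) (n : nat) : lp w -> lp w' ->
  (forall m : int, N <= m -> w m = x) -> (forall m : int, m <= N' -> w' m = x) ->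
  hom (concat w w' N N') (concat w w' N (N' - n%:Z)).
Proof.
move=> wp wp' wN wN'; elim: n => [|n IHn].
  by rewrite subr0; exact/hom_refl/concat_path.
apply: hom_trans IHn _.
have -> : concat w w' N (N' - n.+1%:Z) = ins N (concat w w' N (N' - n%:Z)).
  apply/funext => m; rewrite /ins /concat; have [//|mN] := leP m N.
  have [mN1|mN1] := leP (m - 1) N; last by congr w'; lia.
  by rewrite wN' ?wN //; lia.
apply/hom_ins/concat_path => // m mN; apply: wN'; lia.
Qed.

Lemma concat_shift w w' (N N' : int) (n : nat) :
  (forall m : int, N <= m -> w m = x) -> (forall m : int, m <= N' -> w' m = x) ->
  concat w w' (N + n%:Z) N' = concat w w' N (N' - n%:Z).
Proof.
move=> wN wN'; apply/funext => m; rewrite /concat.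
have [mN|mN] := leP m N; first by rewrite (_ : m <= N + n%:Z = true) //; lia.
have [mN1|mN1] := leP m (N + n%:Z); last by congr w'; lia.
by rewrite wN ?wN' //; lia.
Qed.

Lemma concat_indep w w' (N N' M M' : int) : lp w -> lp w' ->
  (forall m : int, N <= m -> w m = x) -> (forall m : int, m <= N' -> w' m = x) ->
  (forall m : int, M <= m -> w m = x) -> (forall m : int, m <= M' -> w' m = x) ->
  hom (concat w w' N N') (concat w w' M M').
Proof.
move=> wp wp'.
wlog NM : N N' M M' / N <= M => [hw|] wN wN' wM wM'.
  have [/hw|/ltW/hw h] := leP N M; first exact.
  by apply: hom_sym; apply: h.
have [n ->] : exists n : nat, M = N + n%:Z by exists `|M - N|%N; lia.
rewrite concat_shift //.
pose L := Num.min N' (M' - n%:Z).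
have [p pE] : exists p : nat, N' - p%:Z = L by exists `|N' - L|%N; lia.
have [q qE] : exists q : nat, M' - n%:Z - q%:Z = L.
  by exists (absz (M' - n%:Z - L)%R); lia.
apply: hom_trans (concat_indepr p _ _ _ _) _ => //; rewrite pE -qE.
apply: hom_sym; apply: concat_indepr => // m mM; apply: wM'; lia.
Qed.

Lemma concat_hom w1 w2 w1' w2'
    (N1 N1' N2 N2' : int) :
  lp w1 -> lp w2 -> lp w1' -> lp w2' ->
  (forall m : int, N1 <= m -> w1 m = x) -> (forall m : int, m <= N1' -> w1' m = x) ->
  (forall m : int, N2 <= m -> w2 m = x) -> (forall m : int, m <= N2' -> w2' m = x) ->
  hom w1 w2 -> hom w1' w2' ->
  hom (concat w1 w1' N1 N1') (concat w2 w2' N2 N2').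
Proof.
move=> p1 p2 p1' p2' b1 b1' b2 b2' h h'.
have [H [I [F [K [L [Hf HI HF HK HL]]]]]] := homE p1 h.
have [H' [I' [F' [K' [L' [Hf' HI' HF' HK' HL']]]]]] := homE p1' h'.
have c1 m : F <= m -> w1 m = x by move=> mF; rewrite -(HK m K) ?HF.
have c2 m : F <= m -> w2 m = x by move=> mF; rewrite -(HL m L) ?HF.
have c1' m : m <= I' -> w1' m = x by move=> mF; rewrite -(HK' m K') ?HI'.
have c2' m : m <= I' -> w2' m = x by move=> mF; rewrite -(HL' m L') ?HI'.
apply: hom_trans (concat_indep p1 p1' b1 b1' c1 c1') _.
apply: hom_trans (concat_indep p2 p2' c2 c2' b2 b2').
apply: (@homI _ _ (fun m k => concat (H ^~ k) (H' ^~ k) F I' m)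
  (Num.min I F) (Num.max (F + 1) (F' + F - I'))
  (Num.min K K') (Num.max L L')); rewrite /concat.
- move=> m k; have [mF|mF] := leP m F.
    have [mF1|mF1] := leP (m + 1) F; first exact: Hf.
    have -> : m = F by lia.
    rewrite !HF // (_ : F + 1 - F + I' = I' + 1); last by lia.
    by have := Hf' I' k; rewrite !(HI' I' _ (lexx _)).
  have -> : (m + 1 <= F) = false by lia.
  by rewrite (_ : m + 1 - F + I' = m - F + I' + 1) ?Hf' //; lia.
- by move=> m k mI; rewrite (_ : m <= F = true) ?HI //; lia.
- by move=> m k mI; rewrite (_ : m <= F = false) ?HF' //; lia.
- by move=> m k kK; rewrite HK ?HK' //; lia.
- by move=> m k kK; rewrite HL ?HL' //; lia.
Qed.

Lemma const_path : lp (fun=> x).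
Proof.
split; [|by exists 0|by exists 0].
move=> _; apply: (frame_le (frame1 x)); first by exists x; left.
by move=> z [->|->].
Qed.

Lemma rev_path w : lp w -> lp (revpath w).
Proof.
move=> [wf [N wN] [M wM]]; split.
- move=> m; apply: (frame_le (wf (- m - 1))).
    by exists (revpath w m); left.
  by rewrite /revpath addrNK opprD => z [->|->]; [right|left].
- by exists (- M) => m mM; apply: wM; lia.
- by exists (- N) => m mM; apply: wN; lia.
Qed.

Lemma rev_hom w w' : hom w w' -> hom (revpath w) (revpath w').
Proof.
move=> [H [u [v [Hf Hp [K HK] [K' HK']]]]].
exists (fun m k => H (- m) k), v, u; split.
- move=> m k; apply: (frame_le (Hf (- m - 1) k)).
    by exists (H (- m) k); do 3!left.
  rewrite addrNK opprD => z [[[->|->]|->]|->].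
  + by do 2!left; right.
  + by do 3!left.
  + by right.
  + by left; right.
- move=> k; have [wf [N wN] [M wM]] := Hp k; split.
  + move=> m; apply: (frame_le (wf (- m - 1))).
      by exists (H (- m) k); left.
    by rewrite addrNK opprD => z [->|->]; [right|left].
  + by exists (- M) => m mM; apply: wM; lia.
  + by exists (- N) => m mM; apply: wN; lia.
- by exists K => k /HK E; apply/funext => m; rewrite /revpath -E.
- by exists K' => k /HK' E; apply/funext => m; rewrite /revpath -E.
Qed.

Lemma concat_rev w (N : int) : lp w -> (forall m : int, N <= m -> w m = x) ->
  hom (fun=> x) (concat w (revpath w) N (- N)).
Proof.
move=> wp wN; have [wf [L wL] _] := wp.
apply: (@homI _ _ (fun m k => w (Num.min (Num.min m (2 * N - m)) k))
  L (2 * N - L) L N).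
- move=> m k; set f := Num.min m _; set g := Num.min (m + 1) _.
  pose p := Num.min (Num.min f g) k.
  apply: (frame_le (wf p)); first by exists (w (Num.min f k)); do 3!left.
  have step q : q = p \/ q = p + 1 -> [set w p; w (p + 1)] (w q).
    by case=> ->; [left|right].
  by move=> z [[[->|->]|->]|->]; apply: step; lia.
- by move=> m k mL; apply: wL; lia.
- by move=> m k mL; apply: wL; lia.
- by move=> m k kL; apply: wL; lia.
- move=> m k kN; rewrite /concat /revpath; case: leP => mN.
    have [?|?] := leP m k; first by congr w; lia.
    by congr w; lia.
  by congr w; lia.
Qed.

HB.instance Definition _ := gen_eqMixin (loop x).
HB.instance Definition _ := gen_choiceMixin (loop x).

Definition const_loop : loop x := Loop const_path.

Definition rev_loop a : loop x := Loop (rev_path (loopP a)).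

Lemma loop_end a : exists N : int, forall m : int, N <= m -> a m = x.
Proof. by case: (loopP a). Qed.

Lemma loop_start a : exists N : int, forall m : int, m <= N -> a m = x.
Proof. by case: (loopP a). Qed.

Definition concat_loop a b : loop x :=
  Loop (concat_path (loopP a) (loopP b)
          (svalP (cid (loop_end a))) (svalP (cid (loop_start b)))).

Definition loop_hom : rel (loop x) := fun a b => `[< stably_homotopic a b >].

Lemma loop_hom_equiv : equiv_class_of loop_hom.
Proof.
split=> [a|a b|b a c].
- exact/asboolP/hom_refl/loopP.
- by apply/asboolP/asboolP; exact: hom_sym.
- by move=> /asboolP ab /asboolP bc; apply/asboolP; exact: hom_trans ab bc.
Qed.

Canonical loop_hom_equiv_rel := EquivRelPack loop_hom_equiv.

Definition pi1 : Type := {eq_quot loop_hom}.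

HB.instance Definition _ := Choice.on pi1.
HB.instance Definition _ := EqQuotient.on pi1.

Definition pi1_class a : pi1 := \pi_pi1 a.

Definition pi1_mul (u v : pi1) : pi1 :=
  pi1_class (concat_loop (repr u) (repr v)).

Definition pi1_one : pi1 := pi1_class const_loop.

Definition pi1_inv (u : pi1) : pi1 := pi1_class (rev_loop (repr u)).

Lemma pi1_classP a b :
  pi1_class a = pi1_class b <-> stably_homotopic a b.
Proof.
rewrite /pi1_class; split=> [/eqmodP/asboolP //|ab].
by apply/eqmodP/asboolP.
Qed.

Lemma pi1_repr (u : pi1) : pi1_class (repr u) = u.
Proof. exact: reprK. Qed.

(* The class of a product does not depend on the loops chosen in the two
   classes, nor on the times at which they are cut. *)
Lemma pi1_mulE a b c (N N' : int) :
  (forall m : int, N <= m -> a m = x) -> (forall m : int, m <= N' -> b m = x) ->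
  c =1 concat a b N N' ->
  pi1_mul (pi1_class a) (pi1_class b) = pi1_class c.
Proof.
move=> aN bN cE; apply/pi1_classP; rewrite (funext cE).
apply: concat_hom => //; try exact: loopP.
- exact: (svalP (cid (loop_end _))).
- exact: (svalP (cid (loop_start _))).
- by apply/pi1_classP; exact: pi1_repr.
- by apply/pi1_classP; exact: pi1_repr.
Qed.

Lemma pi1_invE a : pi1_inv (pi1_class a) = pi1_class (rev_loop a).
Proof.
by apply/pi1_classP; apply: rev_hom; apply/pi1_classP; exact: pi1_repr.
Qed.

Lemma pi1_mulA : associative pi1_mul.
Proof.
move=> u v w; rewrite -(pi1_repr u) -(pi1_repr v) -(pi1_repr w).
move: (repr u) (repr v) (repr w) => a b c {u v w}.
have [N aN] := loop_end a; have [N' bN'] := loop_start b.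
have [P0 bP0] := loop_end b; have [P' cP'] := loop_start c.
pose P := Num.max P0 N'.
have bP m : P <= m -> b m = x by move=> mP; apply: bP0; lia.
have bcP := concat_path (loopP b) (loopP c) bP cP'.
have abP := concat_path (loopP a) (loopP b) aN bN'.
rewrite (@pi1_mulE b c (Loop bcP) P P') //.
rewrite (@pi1_mulE a b (Loop abP) N N') //.
have ab m : P + N - N' <= m -> concat a b N N' m = x.
  move=> mP; rewrite /concat; case: leP => mN; last by apply: bP; lia.
  by apply: aN; lia.
have bc m : m <= N' -> concat b c P P' m = x.
  move=> mN; rewrite /concat (_ : m <= P = true) ?bN' //; lia.
rewrite (@pi1_mulE a (Loop bcP) (Loop (concat_path (loopP a) bcP aN bc)) N N') //.
apply/esym; apply: (@pi1_mulE (Loop abP) c _ (P + N - N') P') => //= m.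
rewrite /concat; have [mN|mN] := leP m N.
  by rewrite (_ : m <= P + N - N' = true) //; lia.
have [mP|mP] := leP m (P + N - N').
  by rewrite (_ : m - N + N' <= P = true) //; lia.
rewrite (_ : m - N + N' <= P = false); last by lia.
by congr (c _); lia.
Qed.

Lemma pi1_mul1 : left_id pi1_one pi1_mul.
Proof.
move=> u; rewrite -(pi1_repr u); move: (repr u) => a {u}.
have [N aN] := loop_start a; apply: (@pi1_mulE _ _ _ N N) => // m.
by rewrite /concat /= subrK; case: leP => // /aN.
Qed.

Lemma pi1_mul1r : right_id pi1_one pi1_mul.
Proof.
move=> u; rewrite -(pi1_repr u); move: (repr u) => a {u}.
have [N aN] := loop_end a; apply: (@pi1_mulE _ _ _ N N) => // m.
by rewrite /concat /=; case: leP => // /ltW/aN.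
Qed.

Lemma pi1_mulrV : right_inverse pi1_one pi1_inv pi1_mul.
Proof.
move=> u; rewrite -(pi1_repr u); move: (repr u) => a {u}.
have [N aN] := loop_end a; rewrite pi1_invE.
have rN m : m <= - N -> revpath a m = x by move=> mN; apply: aN; lia.
rewrite (@pi1_mulE _ _ (Loop (concat_path (loopP a) (loopP (rev_loop a)) aN rN))
  N (- N)) //.
by apply/esym/pi1_classP/concat_rev => //; exact: loopP.
Qed.

Lemma pi1_mulV : left_inverse pi1_one pi1_inv pi1_mul.
Proof.
move=> u; rewrite -{2}[u](_ : pi1_inv (pi1_inv u) = u) ?pi1_mulrV //.
rewrite -(pi1_repr u) !pi1_invE; congr pi1_class; apply/eqP.
have : rev_loop (rev_loop (repr u)) =1 repr u.
  by move=> m /=; rewrite /revpath opprK.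
move=> /funext; case: (repr u) => f p; rewrite /rev_loop /= => E; apply/eqP.
by move: (rev_path _); rewrite E => q; congr Loop; exact: Prop_irrelevance.
Qed.

HB.instance Definition _ := isGroup.Build pi1
  pi1_mulA pi1_mul1 pi1_mul1r pi1_mulV pi1_mulrV.

End HomotopyTheory.

Section Elementary.
Variables (R : comPzRingType) (n : nat).

Definition GL : set 'M[R]_n :=
  [set A | exists B, A *m B = 1%:M /\ B *m A = 1%:M].

Definition is_subgroup (H : set 'M[R]_n) : Prop :=
  [/\ H `<=` GL, H 1%:M,
      forall A B, H A -> H B -> H (A *m B)
    & forall A B, H A -> A *m B = 1%:M -> B *m A = 1%:M -> H B].

Definition subgroup_gen (S : set 'M[R]_n) : set 'M[R]_n :=
  smallest is_subgroup S.

Definition elem (i j : 'I_n) (r : R) : 'M[R]_n := 1%:M + r *: delta_mx i j.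

Definition Egroup : set 'M[R]_n :=
  subgroup_gen [set A | exists i j r, i != j /\ A = elem i j r].

Definition nilpotent (alpha : {set 'I_n * 'I_n}) : Prop :=
  [/\ forall i j, (i, j) \in alpha -> i != j,
      forall i j, (i, j) \in alpha -> (j, i) \notin alpha
    & forall i j k, (i, j) \in alpha -> (j, k) \in alpha -> (i, k) \in alpha].

Definition Elocal (alpha : {set 'I_n * 'I_n}) : set 'M[R]_n :=
  subgroup_gen [set A | exists i j r, (i, j) \in alpha /\ A = elem i j r].

Definition e1 : 'rV[R]_n := \row_j (j == 0 :> nat)%:R.

Definition EUm_set : set 'rV[R]_n := [set e1 *m A | A in Egroup].

Definition EUm_type : Type := {v : 'rV[R]_n | EUm_set v}.

Definition local_orbit alpha (x : EUm_type) : set EUm_type :=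
  [set y | exists2 A, Elocal alpha A & sval y = sval x *m A].

Definition local_frame (F : set EUm_type) : Prop :=
  [/\ F !=set0, finite_set F
    & exists alpha x, nilpotent alpha /\ F `<=` local_orbit alpha x].

Lemma subgroup_gen1 S : subgroup_gen S 1%:M.
Proof. by move=> H [[]]. Qed.

Lemma local_frame1 x : local_frame [set x].
Proof.
split; [by exists x|exact: finite_set1|exists finset.set0, x; split].
  by split=> [i j|i j|i j k]; rewrite inE.
by move=> _ ->; exists 1%:M; [exact: subgroup_gen1|rewrite mulmx1].
Qed.

Lemma local_frame_sub A B :
  A !=set0 -> A `<=` B -> local_frame B -> local_frame A.
Proof.
move=> A0 AB [_ Bfin [alpha [x [na Bx]]]]; split=> //.
  exact: sub_finite_set Bfin.
by exists alpha, x; split=> // y /AB/Bx.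
Qed.

Definition EUm : frame_space := FrameSpace local_frame1 local_frame_sub.

Lemma e1_EUm : EUm_set e1.
Proof. by exists 1%:M; [exact: subgroup_gen1|rewrite mulmx1]. Qed.

Definition EUm_base : EUm := exist _ e1 e1_EUm.

End Elementary.

(* Main.v *)
Require Import Defs.
From HB Require Import structures.
From mathcomp Require Import all_boot all_order all_algebra.
From mathcomp Require Import zify ring.
From mathcomp Require Import all_classical topology_structure.

Set Implicit Arguments.
Unset Strict Implicit.
Unset Printing Implicit Defensive.

Import Order.TTheory GRing.Theory Num.Theory.

Local Open Scope classical_set_scope.
Local Open Scope ring_scope.
Local Open Scope quotient_scope.

(** Let [o] be the first coordinate, and call the other coordinates the tail.

    Homotopy classes of edge paths from the base point form the universal
    covering of [EUm]. Stepping along an edge acts on these classes, and two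
    steps inside one local frame compose to one step. The fundamental group is
    trivial as soon as this covering has a section which is compatible with the
    steps ([pi1_trivial_of_section]), and the proof constructs such a section.

    The input from ring theory is Bass' stable range theorem
    ([bass_stable_range]): if the maximal ideal space is noetherian of dimension
    at most [d], then a unimodular row of length at least [d + 2] can be
    shortened, that is, suitable multiples of its last entry may be added to the
    other entries so that these become unimodular. As [d + 3 <= n], it applies
    to the tail, which has [n - 1] entries.

    If the tail of [v] is unimodular, then [v] is joined to the base point by a
    canonical path: the multiples of the tail entries change [v o] into 1, and
    multiples of this 1 clear the tail. Each of the two stages lies in
    a local group. This defines the section on these rows, and the question is along
    which edges between them it is compatible. Edges that alter only [v o], or
    that add multiples of one tail entry to the other tail entries, cause no
    difficulty ([compat_first], [compat_shear]).
    The essential case is the edge from [v] to [w] which adds [a * v o] to one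
    tail entry [v j]. It is easy if the tail without [j] is unimodular, because
    the change of [v o] into 1 can then be done without [v j] and lies in the
    same local group as the edge ([compat_core]). In general [v j] and [w j] are
    both units modulo the other tail entries, hence so is their product, and
    stable range provides multiples of [v j * w j] which make the other tail
    entries unimodular when added to them. As [v j * w j] is a multiple of
    [v j] and of [w j], this modification is allowed at both ends of the edge,
    and all four rows lie in one local orbit ([compat_single]).
    For an edge that adds the multiples [t k * v o] to all tail entries, a
    change of basis of the tail reduces to the easy case if [t j = 1] for some
    [j], and one preliminary edge achieves this
    ([compat_shear_first]).

    Any row [v] gets a unimodular tail by adding multiples of [v o] to the tail,
    so the section extends to [v] along such an edge; by the last case the choice
    of the multiples does not matter ([section_rowE]). It remains to check
    the compatibility with the elementary matrices ([section_row_elem]), which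
    generate the local groups. *)

(** * Edge paths and the universal covering *)

Section EdgePaths.
Variables (X : frame_space) (x0 : X).
Implicit Types (x y z : X) (p q : seq X) (w : int -> X).

(** Two loops which differ at one time only are the two rows of a homotopy. *)
Lemma hom_change w w' (m0 : int) :
  is_path x0 x0 w -> is_path x0 x0 w' -> (forall m, m != m0 -> w m = w' m) ->
  frame [set w (m0 - 1); w m0; w' m0] -> frame [set w m0; w' m0; w (m0 + 1)] ->
  stably_homotopic w w'.
Proof.
move=> wp wp' ww' fl fr.
have [wf [N wN] [M wM]] := wp; have [wf' [N' wN'] [M' wM']] := wp'.
apply: (@homI _ _ _ _ (fun m k : int => if k <= 0 then w m else w' m)
  (Num.min N N') (Num.max M M') 0 1).
- move=> m k; case: (leP (k + 1) 0) => k1.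
    by rewrite (_ : k <= 0 = true); [exact: square_const wp|lia].
  case: (leP k 0) => k0; last exact: square_const wp'.
  have [mE|mm0] := eqVneq m m0.
    rewrite mE -(ww' (m0 + 1)); last by lia.
    apply: (frame_le fr); first by exists (w m0); do 3!left.
    by move=> _ [[[->|->]|->]|->]; [left; left|right|left; right|right].
  rewrite -(ww' m) //; have [mE|mm1] := eqVneq (m + 1) m0.
    have {1 3}-> : m = m0 - 1 by lia.
    rewrite mE; apply: (frame_le fl); first by exists (w m0); left; left; right.
    move=> _ [[[->|->]|->]|->]; [left; left|left; right|left; left|right] => //.
  rewrite -(ww' (m + 1)) //; exact: square_const wp.
- by move=> m k mN; case: ifP => _; [apply: wN|apply: wN']; lia.
- by move=> m k mN; case: ifP => _; [apply: wM|apply: wM']; lia.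
- by move=> m k ->.
- by move=> m k k1; rewrite (_ : k <= 0 = false) //; lia.
Qed.

(** The sequence [p] stands for the edge path which starts at [x0] and then
    visits the points of [p]; edge paths are compared up to standing still and
    up to replacing two sides of a triangle by the third one. *)
Inductive edge_homotopic : seq X -> seq X -> Prop :=
| edge_refl p : edge_homotopic p p
| edge_sym p q : edge_homotopic p q -> edge_homotopic q p
| edge_trans p q s :
    edge_homotopic p q -> edge_homotopic q s -> edge_homotopic p s
| edge_stay p q : edge_homotopic (p ++ q) (p ++ last x0 p :: q)
| edge_face p y z q : frame [set last x0 p; y; z] ->
    edge_homotopic (p ++ z :: q) (p ++ y :: z :: q).

Lemma edge_rcons p q x :
  edge_homotopic p q -> edge_homotopic (rcons p x) (rcons q x).
Proof.
elim=> {p q} [p|p q _|p q s _ + _|p q|p y z q f].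
- exact: edge_refl.
- exact: edge_sym.
- exact: edge_trans.
- rewrite !rcons_cat /=; exact: edge_stay.
- rewrite !rcons_cat /=; exact: edge_face.
Qed.

Lemma edge_last p q : edge_homotopic p q -> last x0 p = last x0 q.
Proof.
elim=> {p q} [//|//|p q s _ -> _ -> //|p q|p y z q _].
  by rewrite !last_cat.
by rewrite !last_cat.
Qed.

(** Successive points form local frames; by contrast, [edge_homotopic] relates
    arbitrary sequences. *)
Fixpoint edge_path x p : Prop :=
  if p is y :: p' then frame [set x; y] /\ edge_path y p' else True.

Lemma edge_path_cat x p q :
  edge_path x (p ++ q) <-> edge_path x p /\ edge_path (last x p) q.
Proof.
elim: p x => [|y p IHp] x /=; first by split=> [//|[]].
rewrite IHp; tauto.
Qed.

Lemma frame_pair x : frame [set x; x].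
Proof. by apply: (frame_le (frame1 x)); [exists x; left|move=> _ [->|->]]. Qed.

Lemma edge_homotopic_path p q :
  edge_homotopic p q -> edge_path x0 p <-> edge_path x0 q.
Proof.
elim=> {p q} [//|p q _ -> //|p q s _ -> _ -> //|p q|p y z q f].
  by rewrite !edge_path_cat /=; have := frame_pair (last x0 p); tauto.
rewrite !edge_path_cat /=.
have f1 : frame [set last x0 p; y].
  by apply: (frame_le f); [exists y; right|move=> _ [->|->]; [left; left|left; right]].
have f2 : frame [set last x0 p; z].
  by apply: (frame_le f); [exists z; right|move=> _ [->|->]; [left; left|right]].
have f3 : frame [set y; z].
  by apply: (frame_le f); [exists z; right|move=> _ [->|->]; [left; right|right]].
tauto.
Qed.

Local Notation since N m := (absz (Num.max 0%R (m%R - N%R)%R)).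

(** The path which runs along [p] from time [N] on. A loop returns to [x0] at
    the end of [p], so that the default value of [nth] continues it. *)
Definition walk (N : int) p : int -> X :=
  fun m => nth x0 (x0 :: p) (since N m).

Lemma edge_path_nth x p i : edge_path x p -> (i < size p)%N ->
  frame [set nth x0 (x :: p) i; nth x0 (x :: p) i.+1].
Proof.
elim: p x i => [//|y p IHp] x [|i] /= [f yp] ip //.
exact: IHp yp ip.
Qed.

Lemma walk_path N p :
  edge_path x0 p -> last x0 p = x0 -> is_path x0 x0 (walk N p).
Proof.
move=> pp pl; split.
- move=> m; rewrite /walk; have [mN|mN] := ltP m N.
    have -> : Num.max 0 (m - N) = 0 by lia.
    have -> : Num.max 0 (m + 1 - N) = 0 by lia.
    exact: frame_pair.
  have -> : (since N (m + 1)) = (since N m).+1 by lia.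
  move: (absz _) => i; have [ip|pi] := ltnP i (size p); first exact: edge_path_nth.
  rewrite [nth _ _ i.+1]nth_default //.
  have -> : nth x0 (x0 :: p) i = x0; last exact: frame_pair.
  have [->|ip] := eqVneq i (size p); first by rewrite -last_nth.
  by rewrite nth_default //=; lia.
- exists N => m mN; rewrite /walk (_ : Num.max 0 (m - N) = 0) //; lia.
- exists (N + (size p)%:Z + 1) => m mN; rewrite /walk nth_default //=; lia.
Qed.

Lemma walk_stay N p q :
  walk N (p ++ last x0 p :: q) = ins (N + (size p)%:Z) (walk N (p ++ q)).
Proof.
apply/funext => m; rewrite /ins /walk.
have [mN|mN] := leP m (N + (size p)%:Z).
  have : ((since N m) <= size p)%N by lia.
  move: (absz _) => i ip; rewrite -!cat_cons !nth_cat /=.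
  by rewrite (_ : (i < (size p).+1)%N).
have -> : (since N m) = (since N (m - 1)).+1 by lia.
have : (size p <= (since N (m - 1)))%N by lia.
move: (absz _) => i ip; rewrite -!cat_cons !nth_cat /= ltnS ltnNge ip /=.
have [->|ip'] := eqVneq i (size p).
  by rewrite ltnSn subnn /= -last_nth.
have -> : (i < (size p).+1)%N = false by lia.
by rewrite subSS; have -> : (i - size p = (i - (size p).+1).+1)%N by lia.
Qed.

(** Standing still is an insertion in the sense of [ins]. Replacing a side
    [x z] of a triangle by [x y z] is done by standing still at [x] first and
    then moving the inserted point from [x] to [y]. *)
Lemma edge_homotopic_walk N p q : edge_homotopic p q ->
  edge_path x0 p -> last x0 p = x0 ->
  stably_homotopic (walk N p) (walk N q).
Proof.
have stay p' q' : edge_path x0 (p' ++ q') -> last x0 (p' ++ q') = x0 ->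
    stably_homotopic (walk N (p' ++ q')) (walk N (p' ++ last x0 p' :: q')).
  by move=> pp pl; rewrite walk_stay; apply: hom_ins; exact: walk_path.
elim=> {p q} [p|p q pq IH|p q s pq IHpq qs IHqs|p q|p y z q f].
- by move=> pp pl; exact/hom_refl/walk_path.
- move=> qp ql; apply: hom_sym; apply: IH; first exact/(edge_homotopic_path pq).
  by rewrite (edge_last pq).
- move=> pp pl; apply: hom_trans (IHpq pp pl) (IHqs _ _).
    exact/(edge_homotopic_path pq).
  by rewrite -(edge_last pq).
- exact: stay.
- move=> pp pl; apply: hom_trans (stay _ _ pp pl) _.
  have E1 := edge_stay p (z :: q); have E2 := edge_face q f.
  pose x := last x0 p.
  have at_ u i : walk N (p ++ u :: z :: q) (N + (size p)%:Z + i%:Z) =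
      nth x0 (x :: u :: z :: q) i.
    rewrite /walk (_ : (absz _) = (size p + i)%N); last by lia.
    rewrite -cat_cons nth_cat /=.
    case: i => [|i]; first by rewrite addn0 ltnSn -last_nth.
    by rewrite addnS ltnS ltnNge leq_addr /= subSS addKn.
  have at0 u : walk N (p ++ u :: z :: q) (N + (size p)%:Z + 1 - 1) = x.
    by rewrite addrK -[N + _]addr0 (at_ u 0%N).
  have at2 u : walk N (p ++ u :: z :: q) (N + (size p)%:Z + 1 + 1) = z.
    by rewrite -addrA (at_ u 2%N).
  apply: (@hom_change _ _ (N + (size p)%:Z + 1)).
  + by apply: walk_path; [exact/(edge_homotopic_path E1)|rewrite -(edge_last E1)].
  + by apply: walk_path; [exact/(edge_homotopic_path E2)|rewrite -(edge_last E2)].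
  + move=> m mN; rewrite /walk -!cat_cons !nth_cat /=.
    case: ltnP => //; case E: (_ - _)%N => [|i] //; lia.
  + rewrite at0 !(at_ _ 1%N) /=; apply: (frame_le f); first by exists y; right.
    by move=> _ [[->|->]|->]; [left; left|left; left|left; right].
  + rewrite at2 !(at_ _ 1%N) /=; apply: (frame_le f); first by exists y; left; right.
    by move=> _ [[->|->]|->]; [left; left|left; right|right].
Qed.

HB.instance Definition _ := gen_eqMixin X.
HB.instance Definition _ := gen_choiceMixin X.

Definition edge_rel : rel (seq X) := fun p q => `[< edge_homotopic p q >].

Lemma edge_rel_equiv : equiv_class_of edge_rel.
Proof.
split=> [p|p q|q p s].
- exact/asboolP/edge_refl.
- by apply/asboolP/asboolP; exact: edge_sym.
- by move=> /asboolP pq /asboolP qs; apply/asboolP; exact: edge_trans pq qs.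
Qed.

Canonical edge_equiv := EquivRelPack edge_rel_equiv.

(** The universal covering of [X]: the homotopy classes of edge paths from
    [x0]. *)
Definition edge_class : Type := {eq_quot edge_rel}.

HB.instance Definition _ := Choice.on edge_class.
HB.instance Definition _ := EqQuotient.on edge_class.

Definition class p : edge_class := \pi_edge_class p.

Definition class_end (c : edge_class) : X := last x0 (repr c).

Definition class_step (c : edge_class) x : edge_class := class (rcons (repr c) x).

Lemma classP p q : class p = class q <-> edge_homotopic p q.
Proof. by split=> [/eqmodP/asboolP|pq] //; apply/eqmodP/asboolP. Qed.

Lemma class_repr c : class (repr c) = c.
Proof. exact: reprK. Qed.

Lemma class_stepE p x : class_step (class p) x = class (rcons p x).
Proof. by apply/classP/edge_rcons/classP; rewrite class_repr. Qed.

Lemma class_endE p : class_end (class p) = last x0 p.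
Proof. by apply: edge_last; apply/classP; rewrite class_repr. Qed.

Lemma class_end_step c x : class_end (class_step c x) = x.
Proof. by rewrite class_endE last_rcons. Qed.

Lemma class_step_end c : class_step c (class_end c) = c.
Proof.
rewrite -[in RHS](class_repr c); apply/classP/edge_sym.
by rewrite -cats1 -[X in edge_homotopic X]cats0; exact: edge_stay.
Qed.

Lemma class_step_step c x y : frame [set class_end c; x; y] ->
  class_step (class_step c x) y = class_step c y.
Proof.
move=> f; rewrite [class_step c x]/class_step class_stepE; apply/classP/edge_sym.
by rewrite -!cats1 -catA; exact: edge_face.
Qed.

(** If the covering by edge path classes has a section, then a loop lifts to
    the values of the section along it, hence it closes up in the covering. *)
Lemma pi1_trivial_of_section (tau : X -> edge_class) :
  tau x0 = class [::] ->
  (forall x y, frame [set x; y] -> class_step (tau x) y = tau y) ->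
  forall u : pi1 x0, u = 1%g.
Proof.
move=> tau0 tauP u; rewrite -(pi1_repr u); apply/pi1_classP.
move: (repr u) => w {u}; have [wf [N wN] [M wM]] := loopP w.
pose p := [seq w (N + i.+1%:Z) | i <- iota 0 (since N M)].
have liftE k : class [seq w (N + i.+1%:Z) | i <- iota 0 k] = tau (w (N + k%:Z)) /\
    edge_path x0 [seq w (N + i.+1%:Z) | i <- iota 0 k] /\
    last x0 [seq w (N + i.+1%:Z) | i <- iota 0 k] = w (N + k%:Z).
  elim: k => [|k [IHc [IHp IHl]]]; first by rewrite /= addr0 wN.
  have fk : frame [set w (N + k%:Z); w (N + k.+1%:Z)].
    by have -> : N + k.+1%:Z = N + k%:Z + 1 by lia.
  rewrite -addn1 iotaD add0n map_cat /= cats1 last_rcons addn1; split; [|split=> //].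
    by rewrite -class_stepE IHc tauP.
  by rewrite -cats1 edge_path_cat /= IHl.
have [pc [pp pl]] := liftE (since N M).
have wend : w (N + (since N M)%:Z) = x0 by apply: wM; lia.
rewrite -/p in pc pp pl; rewrite wend in pc pl.
have wE : w = walk N p :> (int -> X).
  apply/funext => m; rewrite /walk; have [mN|mN] := leP m N.
    by rewrite wN // (_ : Num.max 0 (m - N) = 0) //; lia.
  have [i ->] : exists i : nat, m = N + i.+1%:Z by exists (since N (m - 1)); lia.
  have -> : Num.max 0 (N + i.+1%:Z - N) = i.+1 by lia.
  rewrite /=.
  have [ip|pi] := ltnP i (since N M).
    by rewrite (nth_map 0%N) ?size_iota // nth_iota.
  by rewrite nth_default ?size_map ?size_iota // wM //; lia.
have constE : walk N [::] = fun=> x0.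
  by apply/funext => m; rewrite /walk; case: (absz _) => // i; rewrite /= nth_nil.
rewrite wE /= -constE.
by apply: edge_homotopic_walk => //; apply/classP; rewrite pc tau0.
Qed.

End EdgePaths.

(** * Stable range and the dimension of the maximal ideal space *)

Section NoetherianSpaces.
Variable T : topologicalType.
Implicit Types (A B C W Z : set T).

Lemma noetherian_ind (P : set T -> Prop) : noetherian_space T ->
  (forall C, closed C -> (forall C', closed C' -> C' `<` C -> P C') -> P C) ->
  forall C, closed C -> P C.
Proof.
move=> noethT IH C Ccl; apply: contrapT => nPC.
pose bad := {C | closed C /\ ~ P C}.
have /choice[next nextP] : forall C : bad, exists C' : bad, sval C' `<` sval C.
  move=> [D [Dcl nPD]] /=; apply: contrapT => noC'; apply: nPD.
  apply: IH => // D' D'cl DD'.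
  by apply: contrapT => nPD'; apply: noC'; exists (exist _ D' (conj D'cl nPD')).
pose F i : set T := sval (iter i next (exist _ C (conj Ccl nPC))).
pose G i : bad := iter i next (exist _ C (conj Ccl nPC)).
have [|i|N FN] := noethT F.
- by move=> i; have [] := svalP (G i).
- by have [] := nextP (G i).
by have [_] := nextP (G N); apply; rewrite -/(F N) -(FN N.+1).
Qed.

(** This replaces the decomposition of [C] into irreducible components: [L]
    contains a point outside [W] on each component that [W] does not contain. *)
Lemma component_marks W C : noetherian_space T -> closed C ->
  exists L : seq T, (forall m, m \in L -> C m /\ ~ W m) /\
    forall Z, closed Z -> irreducible_set Z -> Z `<=` C -> ~ Z `<=` W ->
    exists Z', [/\ closed Z', irreducible_set Z', Z `<=` Z' , Z' `<=` C &
                   exists2 m, m \in L & Z' m].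
Proof.
move=> noethT; move: C; apply: noetherian_ind => // C Ccl IH.
have [[x Cx]|C0] := pselect (C !=set0); last first.
  exists [::]; split=> // Z _ [[z Zz] _] ZC _; exfalso; apply: C0.
  by exists z; exact: ZC.
have [Cirr|Cred] := pselect (irreducible_set C).
  have [CW|/existsNP[m /not_implyP[Cm Wm]]] := pselect (C `<=` W).
    exists [::]; split=> // Z _ _ ZC ZW; exfalso; apply: ZW.
    exact: subset_trans ZC CW.
  exists [:: m]; split=> [m'|Z _ _ ZC _]; first by rewrite inE => /eqP->.
  by exists C; split=> //; exists m => //; rewrite inE.
have [A [B [Acl Bcl CAB nCA nCB]]] : exists A B, [/\ closed A, closed B,
    C `<=` A `|` B, ~ C `<=` A & ~ C `<=` B].
  apply: contrapT => noAB; apply: Cred; split; first by exists x.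
  move=> A B Acl Bcl CAB; apply: contrapT => /not_orP[nCA nCB].
  by apply: noAB; exists A, B.
have sub D : ~ C `<=` D -> C `&` D `<` C.
  by move=> nCD; split=> [|CCD]; [exact: subIsetl|apply: nCD => z /CCD[]].
have [LA [LAC LAP]] := IH _ (closedI Ccl Acl) (sub _ nCA).
have [LB [LBC LBP]] := IH _ (closedI Ccl Bcl) (sub _ nCB).
exists (LA ++ LB); split.
  by move=> m; rewrite mem_cat => /orP[/LAC|/LBC] [[? _] ?].
move=> Z Zcl Zirr ZC ZW.
have [ZA|ZB] := Zirr.2 A B Acl Bcl (subset_trans ZC CAB).
  have [|Z' [Z'cl Z'irr ZZ' Z'C [m mL Z'm]]] := LAP Z Zcl Zirr _ ZW.
    by move=> z Zz; split; [exact: ZC|exact: ZA].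
  exists Z'; split=> //; first by move=> z /Z'C[].
  by exists m => //; rewrite mem_cat mL.
have [|Z' [Z'cl Z'irr ZZ' Z'C [m mL Z'm]]] := LBP Z Zcl Zirr _ ZW.
  by move=> z Zz; split; [exact: ZC|exact: ZB].
exists Z'; split=> //; first by move=> z /Z'C[].
by exists m => //; rewrite mem_cat mL orbT.
Qed.

End NoetherianSpaces.

Section StableRange.
Variable R : comPzRingType.
Implicit Types (m : max_spec R) (p b t : R).

Lemma max_ideal m : ideal (sval m).
Proof. by case: (svalP m). Qed.

Lemma max_ideal_neq1 m : ~ sval m 1.
Proof.
move=> m1; have [[_ _ mM] /eqP mT _] := svalP m; apply: mT.
by apply/seteqP; split=> // x _; rewrite -[x]mulr1; exact: mM.
Qed.

Lemma ideal_opp (I : set R) x : ideal I -> I x -> I (- x).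
Proof. by move=> [_ _ IM] Ix; rewrite -mulN1r; exact: IM. Qed.

Lemma max_ideal_subset m m' : sval m `<=` sval m' -> m = m'.
Proof.
move=> mm'; have [_ _ mmax] := svalP m.
have [E|E] := mmax _ (max_ideal m') mm'; last first.
  by exfalso; apply: (@max_ideal_neq1 m'); rewrite E.
case: m m' E {mm' mmax} => [I mI] [I' mI'] /= E.
by move: mI'; rewrite E => mI'; congr exist; exact: Prop_irrelevance.
Qed.

Lemma closed_zero_locus (S : set R) : closed (zero_locus S).
Proof.
by rewrite -[zero_locus S]setCK closedC; exists S; rewrite setCK.
Qed.

Lemma closed_max_ideal m : closed [set m].
Proof.
rewrite (_ : [set m] = zero_locus (sval m)); first exact: closed_zero_locus.
apply/seteqP; split=> [_ ->|m' /= mm']; first by move=> x.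
by rewrite (max_ideal_subset mm').
Qed.

Lemma exists_max_ideal (I : set R) : ideal I -> ~ I 1 ->
  exists m, I `<=` sval m.
Proof.
move=> [I0 ID IM] I1.
pose P (A : set R) := ideal (I `|` A) /\ ~ (I `|` A) 1.
have [F FP Ftot|J [[JI J1] Jmax]] := @Zorn_bigcup R P.
  split; last by case=> // -[A FA A1]; have [_ []] := FP A FA; right.
  have inU A z : F A -> (I `|` A) z -> (I `|` \bigcup_(X in F) X) z.
    by move=> FA [Iz|Az]; [left|right; exists A].
  split=> [|x y|a x]; first by left.
    move=> [Ix|[A FA Ax]] [Iy|[B FB By]].
    - by left; exact: ID.
    - have [[_ BD _] _] := FP B FB; apply: (inU B) => //.
      by apply: BD; [left|right].
    - have [[_ AD _] _] := FP A FA; apply: (inU A) => //.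
      by apply: AD; [right|left].
    - have [AB|BA] := Ftot A B FA FB.
        have [[_ BD _] _] := FP B FB; apply: (inU B) => //.
        by apply: BD; right => //; exact: AB.
      have [[_ AD _] _] := FP A FA; apply: (inU A) => //.
      by apply: AD; right => //; exact: BA.
  move=> [Ix|[A FA Ax]]; first by left; exact: IM.
  have [[_ _ AM] _] := FP A FA; apply: (inU A) => //.
  by apply: AM; right.
have mJ : maximal_ideal (I `|` J).
  split=> //; first by apply/eqP => E; apply: J1; rewrite E.
  move=> K KI JK; have [K1|K1] := pselect (K 1).
    right; apply/seteqP; split=> // x _; have [_ _ KM] := KI.
    by rewrite -[x]mulr1; exact: KM.
  left; apply: contrapT => KJ; apply: (Jmax K).
    split=> [|KJ']; first by move=> x Jx; apply: JK; right.
    by apply: KJ; apply/seteqP; split=> // x Kx; right; exact: KJ'.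
  have IK : I `|` K = K.
    by apply/seteqP; split=> x; [case=> // Ix; apply: JK; left|right].
  by split; rewrite IK.
by exists (exist _ _ mJ) => x Ix; left.
Qed.

Definition unimodular (I : finType) (D : pred I) (f : I -> R) : Prop :=
  exists c : I -> R, \sum_(i | D i) c i * f i = 1.

(** The right hand side says that the ideal generated by the entries lies in no
    maximal ideal. In this form unimodularity is easily seen to be invariant
    under elementary operations. *)
Lemma unimodularP (I : finType) (D : pred I) (f : I -> R) :
  unimodular D f <-> forall m, exists2 i, D i & ~ sval m (f i).
Proof.
split=> [[c cf] m|noM].
  apply: contrapT => noi; apply: (@max_ideal_neq1 m); rewrite -cf.
  have [m0 mD mM] := max_ideal m; apply: big_ind => // i Di; apply: mM.
  by apply: contrapT => mfi; apply: noi; exists i.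
pose J := [set x | exists c : I -> R, x = \sum_(i | D i) c i * f i].
have JI : ideal J.
  split.
  - by exists (fun=> 0); rewrite big1 // => i _; rewrite mul0r.
  - move=> _ _ [c ->] [c' ->]; exists (fun i => c i + c' i).
    by rewrite -big_split; apply: eq_bigr => i _; rewrite mulrDl.
  - move=> a _ [c ->]; exists (fun i => a * c i).
    by rewrite mulr_sumr; apply: eq_bigr => i _; rewrite mulrA.
have [[c cE]|J1] := pselect (J 1); first by exists c.
have [m Jm] := exists_max_ideal JI J1; have [i Di mfi] := noM m.
exfalso; apply: mfi; apply: Jm; exists (fun k => (k == i)%:R).
rewrite (bigD1 i) //= eqxx mul1r big1 ?addr0 // => k /andP[_ /negPf->].
by rewrite mul0r.
Qed.

(** As in the Chinese remainder theorem, [t] is corrected at one maximal ideal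
    after the other, each time by an element of all the ideals treated before. *)
Lemma avoid_max_ideals (L : seq (max_spec R)) p b :
  (forall m, m \in L -> ~ sval m p) ->
  exists t, forall m, m \in L -> ~ sval m (b + t * p).
Proof.
elim: L => [|m0 L IHL] Lp; first by exists 0.
have [|t tP] := IHL; first by move=> m mL; apply: Lp; rewrite inE mL orbT.
have [good|/contrapT bad] := pselect (~ sval m0 (b + t * p)).
  by exists t => m; rewrite inE => /orP[/eqP->|/tP].
have [s sL sm0] : exists2 s, (forall m, m \in L -> sval m s) & ~ sval m0 s.
  have : forall m, m \in L -> m != m0.
    by move=> m mL; apply/eqP => mE; apply: (tP _ mL); rewrite mE.
  elim: (L) => [|m1 L' IHL'] L'm0; first by exists 1 => //; exact: max_ideal_neq1.
  have [|s sL' sm0] := IHL'; first by move=> m mL; apply: L'm0; rewrite inE mL orbT.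
  have [x m1x m0x] : exists2 x, sval m1 x & ~ sval m0 x.
    have m10 : ~ sval m1 `<=` sval m0.
      by move=> /max_ideal_subset E; have := L'm0 m1; rewrite inE E !eqxx => /(_ isT).
    by have /existsNP[x /not_implyP[]] := m10; exists x.
  exists (x * s) => [m|/(maximal_ideal_prime (svalP m0))[]//].
  rewrite inE => /orP[/eqP->|/sL' ms].
    by rewrite mulrC; have [_ _] := max_ideal m1; apply.
  by have [_ _] := max_ideal m; apply.
have addE : b + (t + s) * p = (b + t * p) + s * p by ring.
exists (t + s) => m; rewrite inE addE => /orP[/eqP->|mL].
  move=> bad'; have : sval m0 (s * p).
    have -> : s * p = (b + t * p + s * p) + - (b + t * p) by ring.
    have mI := max_ideal m0; have [_ mD _] := mI; apply: mD => //.
    exact: (ideal_opp mI).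
  case/(maximal_ideal_prime (svalP m0)) => //.
  by apply: Lp; rewrite inE eqxx.
move=> bad'; apply: (tP m mL).
have -> : b + t * p = (b + t * p + s * p) + - (s * p) by ring.
have mI := max_ideal m; have [_ mD mM] := mI; apply: mD => //.
by apply: (ideal_opp mI); rewrite mulrC; apply: mM; exact: sL.
Qed.

(** The closed irreducible set [Z] has codimension at least [k]. *)
Definition chain_above (Z : set (max_spec R)) (k : nat) : Prop :=
  exists F : nat -> set (max_spec R), [/\ F 0%N = Z,
    forall i, (i <= k)%N -> closed (F i) /\ irreducible_set (F i) &
    forall i, (i < k)%N -> F i `<` F i.+1].

(** Each further entry [f i + t i * p] can be chosen outside one maximal ideal
    on every component of the previous zero locus, except for the components on
    which [p] vanishes. This raises the codimension of the other components. *)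
Lemma codim_general_position (I : eqType) (s : seq I) (f : I -> R) p :
  noetherian_space (max_spec R) -> uniq s ->
  exists t : I -> R, forall Z, closed Z -> irreducible_set Z ->
    Z `<=` zero_locus [set f i + t i * p | i in [set i | i \in s]] ->
    ~ Z `<=` zero_locus [set p] -> chain_above Z (size s).
Proof.
move=> noethR; elim: s => [|i0 s IHs] /=.
  move=> _; exists (fun=> 0) => Z Zcl Zirr _ _.
  by exists (fun=> Z); split=> // -[].
case/andP=> i0s /IHs[t tP] {IHs}.
pose C := zero_locus [set f i + t i * p | i in [set i | i \in s]].
have [L [LC LP]] := component_marks (zero_locus [set p]) noethR
  (@closed_zero_locus [set f i + t i * p | i in [set i | i \in s]]).
have [|t0 t0P] := @avoid_max_ideals L p (f i0).
  by move=> m /LC[_ mp] pm; apply: mp => _ ->.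
exists (fun i => if i == i0 then t0 else t i) => Z Zcl Zirr ZV Zp.
have ZC : Z `<=` C.
  move=> m /ZV mV _ [i /= is_ <-]; have [ii0|ii0] := eqVneq i i0.
    by rewrite -ii0 is_ in i0s.
  apply: mV; exists i; first by rewrite /= inE is_ orbT.
  by rewrite (negPf ii0).
have [Z' [Z'cl Z'irr ZZ' Z'C [m mL Z'm]]] := LP Z Zcl Zirr ZC Zp.
have [F [F0 Fcl Flt]] := tP Z' Z'cl Z'irr Z'C (fun h => Zp (subset_trans ZZ' h)).
have ltZ : Z `<` Z'.
  split=> // Z'Z; apply: (t0P m mL); apply: (ZV m (Z'Z m Z'm)).
  by exists i0; rewrite /= ?inE ?eqxx.
exists (fun k => if k is k'.+1 then F k' else Z); split=> // -[|k] //=.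
- by move=> ks; apply: Fcl.
- by rewrite F0.
- by move=> ks; apply: Flt.
Qed.

(** Bass' stable range theorem: by [codim_general_position], a common zero of
    the entries [f i + t i * p] at which [p] does not vanish would have
    codimension greater than [d]; a common zero of these entries and of [p] is
    excluded by the unimodularity of the longer row. *)
Theorem bass_stable_range (I : finType) (D : pred I) (f c : I -> R) (p q : R)
    (d : nat) :
  noetherian_space (max_spec R) -> krull_dim_le (max_spec R) d ->
  (d < #|D|)%N ->
  \sum_(i | D i) c i * f i + q * p = 1 ->
  exists t : I -> R, unimodular D (fun i => f i + t i * p).
Proof.
move=> noethR dimR dD cE.
have [t tP] := codim_general_position f p noethR (enum_uniq D).
exists t; apply/unimodularP => m; apply: contrapT => noi.
have mV i : D i -> sval m (f i + t i * p).
  by move=> Di; apply: contrapT => mi; apply: noi; exists i.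
have mI := max_ideal m; have [m0 mD mM] := mI.
have [mp|mp] := pselect (sval m p).
  apply: (@max_ideal_neq1 m); rewrite -cE; apply: (mD); last exact: mM.
  apply: big_ind => [|x y mx my|i Di]; [exact: m0|exact: mD|apply: (mM)].
  have -> : f i = (f i + t i * p) + - (t i * p) by ring.
  apply: mD; first exact: mV.
  by apply: (ideal_opp mI); exact: mM.
have [||||F [F0 Fcl Flt]] := tP [set m].
- exact: closed_max_ideal.
- split; first by exists m.
  by move=> B C _ _ /(_ m erefl) [mB|mC]; [left|right] => _ ->.
- by move=> _ -> _ [i /= iD <-]; apply: mV; rewrite mem_enum in iD.
- by move=> /(_ m erefl) /(_ p erefl).
have := dimR _ F Fcl Flt; rewrite -cardE leqNgt => /negP[].
exact: dD.
Qed.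

End StableRange.

(** * Orbits of the local groups *)

Section LocalOrbits.
Variables (R : comPzRingType) (n : nat).
Implicit Types (f : 'I_n -> nat) (u v w x : 'rV[R]_n) (i j k : 'I_n).
Implicit Types (r s : R) (alpha : {set 'I_n * 'I_n}) (A B C : 'M[R]_n).

Lemma mulmx_elem v i j r k :
  (v *m elem i j r) 0 k = v 0 k + (if k == j then r * v 0 i else 0).
Proof.
rewrite /elem mulmxDr mulmx1 -scalemxAr !mxE; congr (_ + _).
rewrite (bigD1 i) //= mxE eqxx /= big1 ?addr0 => [|l /negPf li]; last first.
  by rewrite mxE li mulr0.
by case: eqP => _; rewrite ?mulr1 // !mulr0.
Qed.

Lemma subgroup_gen_mul (S : set 'M[R]_n) A B :
  subgroup_gen S A -> subgroup_gen S B -> subgroup_gen S (A *m B).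
Proof.
move=> SA SB H [HS SH]; have [_ _ HM _] := HS.
by apply: HM; [exact: SA|exact: SB].
Qed.

Lemma subgroup_gen_inv (S : set 'M[R]_n) A B :
  subgroup_gen S A -> A *m B = 1%:M -> B *m A = 1%:M -> subgroup_gen S B.
Proof.
move=> SA AB BA H [HS SH]; have [_ _ _ HV] := HS.
by apply: HV AB BA; exact: SA.
Qed.

Lemma subgroup_gen_sub (S S' : set 'M[R]_n) : S `<=` S' ->
  subgroup_gen S `<=` subgroup_gen S'.
Proof.
by move=> SS' A SA H [HS SH]; apply: SA; split=> //; exact: subset_trans SH.
Qed.

Lemma subgroup_gen_in (S : set 'M[R]_n) : S `<=` subgroup_gen S.
Proof. by move=> A SA H [_]; apply. Qed.

Lemma GL_subgroup : is_subgroup (@GL R n).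
Proof.
split=> // [|A B [A' [AA' A'A]] [B' [BB' B'B]]|A B _ AB BA]; last by exists A.
  by exists 1%:M; rewrite mulmx1.
exists (B' *m A'); split.
  by rewrite mulmxA -(mulmxA A) BB' mulmx1.
by rewrite mulmxA -(mulmxA B') A'A mulmx1.
Qed.

Lemma elem_mul i j r s : i != j -> elem i j r *m elem i j s = elem i j (r + s).
Proof.
move=> ij; apply/row_matrixP => l; apply/rowP => k.
rewrite row_mul mulmx_elem !mxE; case: (eqVneq k j) => [->|kj].
  by rewrite (negPf ij) !andbT !andbF mulr0 addr0; ring.
by rewrite !andbF !mulr0 !addr0.
Qed.

Lemma elem_GL i j r : i != j -> GL (elem i j r : 'M[R]_n).
Proof.
move=> ij; exists (elem i j (- r)); rewrite !elem_mul // subrr addNr.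
by rewrite /elem scale0r addr0.
Qed.

Lemma Elocal_GL alpha : nilpotent alpha -> @Elocal R n alpha `<=` @GL R n.
Proof.
move=> [neq _ _] A; apply; split; first exact: GL_subgroup.
by move=> _ [i [j [r [ij ->]]]]; apply: elem_GL; exact: neq.
Qed.

Lemma Elocal_Egroup alpha : nilpotent alpha -> @Elocal R n alpha `<=` @Egroup R n.
Proof.
move=> [neq _ _]; apply: subgroup_gen_sub => _ [i [j [r [ij ->]]]].
by exists i, j, r; split=> //; exact: neq.
Qed.

Lemma EUm_mul alpha v A : nilpotent alpha -> EUm_set v -> Elocal alpha A ->
  EUm_set (v *m A).
Proof.
move=> na [B EB <-] EA; exists (B *m A); last by rewrite mulmxA.
by apply: subgroup_gen_mul EB _; exact: Elocal_Egroup EA.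
Qed.

(** The base point is a dummy value for the rows outside the orbit of [e1]. *)
Definition row_point v : EUm R n :=
  if pselect (EUm_set v) is left h then exist _ v h else EUm_base R n.

Lemma row_point_val v : EUm_set v -> sval (row_point v) = v.
Proof. by rewrite /row_point; case: pselect. Qed.

Lemma row_point_sval (y : EUm R n) : row_point (sval y) = y.
Proof.
case: y => v h; rewrite /row_point /=; case: pselect => // h'.
by congr exist; exact: Prop_irrelevance.
Qed.

Lemma frame_Elocal alpha v A B C : nilpotent alpha -> EUm_set v ->
  Elocal alpha A -> Elocal alpha B -> Elocal alpha C ->
  frame [set row_point (v *m A); row_point (v *m B); row_point (v *m C)].
Proof.
move=> na Ev EA EB EC; split.
- by exists (row_point (v *m C)); right.
- by rewrite !finite_setU; split; [split|]; exact: finite_set1.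
- exists alpha, (row_point v); split=> // _ [[->|->]|->].
  + by exists A => //; rewrite !row_point_val //; exact: EUm_mul EA.
  + by exists B => //; rewrite !row_point_val //; exact: EUm_mul EB.
  + by exists C => //; rewrite !row_point_val //; exact: EUm_mul EC.
Qed.

(** The local frames that serve to construct the section all come from rankings
    of the coordinates: multiples of a coordinate may be added to those of larger
    rank. *)
Definition ranked f : {set 'I_n * 'I_n} := [set ij | (f ij.1 < f ij.2)%N]%SET.

Lemma nilpotent_ranked f : nilpotent (ranked f).
Proof.
split=> [i j|i j|i j k]; rewrite !inE /=; try lia.
by apply: contraL => /eqP->; rewrite ltnn.
Qed.

Definition low f v k (a : R) : Prop :=
  exists c : 'I_n -> R, a = \sum_(i | (f i < f k)%N) c i * v 0 i.

(** As the coefficients may depend on the row, membership in an orbit of a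
    local group becomes a condition on ideals: each coordinate changes by an
    element of the ideal generated by the coordinates of smaller rank. *)
Definition lower f v w : Prop := forall k, low f v k (w 0 k - v 0 k).

Lemma low0 f v k : low f v k 0.
Proof. by exists (fun=> 0); rewrite big1 // => i _; rewrite mul0r. Qed.

Lemma lowD f v k a b : low f v k a -> low f v k b -> low f v k (a + b).
Proof.
move=> [c ->] [c' ->]; exists (fun i => c i + c' i).
by rewrite -big_split; apply: eq_bigr => i _; rewrite mulrDl.
Qed.

Lemma lowM f v k r i : (f i < f k)%N -> low f v k (r * v 0 i).
Proof.
move=> fik; exists (fun l => if l == i then r else 0).
rewrite (bigD1 i) //= eqxx big1 ?addr0 // => l /andP[_ /negPf->].
by rewrite mul0r.
Qed.

(** If the coordinates of smaller rank are unimodular, then a coordinate may be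
    changed at will. *)
Lemma low_unimodular f v k (D : pred 'I_n) a :
  unimodular D (v 0) -> (forall i, D i -> (f i < f k)%N) -> low f v k a.
Proof.
move=> [c cE] fD; rewrite -[a]mulr1 -cE mulr_sumr.
apply: big_ind => [|b b'|i Di]; [exact: low0|exact: lowD|].
by rewrite mulrA; apply/lowM/fD.
Qed.

Lemma lower_refl f v : lower f v v.
Proof. by move=> k; rewrite subrr; exact: low0. Qed.

Lemma Elocal_add_sum f v j (c : 'I_n -> R) (s : seq 'I_n) :
  (forall i, i \in s -> (f i < f j)%N) ->
  exists2 A, Elocal (ranked f) A & v *m A =
    \row_k (v 0 k + if k == j then \sum_(i <- s) c i * v 0 i else 0).
Proof.
elim: s => [|i s IHs] fs.
  exists 1%:M; first exact: subgroup_gen1.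
  by apply/rowP => k; rewrite mulmx1 mxE big_nil if_same addr0.
have [|A EA vA] := IHs; first by move=> l ls; apply: fs; rewrite inE ls orbT.
have fij : (f i < f j)%N by apply: fs; rewrite inE eqxx.
exists (A *m elem i j (c i)).
  apply: subgroup_gen_mul EA _; apply: subgroup_gen_in.
  by exists i, j, (c i); rewrite inE.
apply/rowP => k; rewrite mulmxA vA mulmx_elem !mxE big_cons.
have /negPf-> : i != j by apply: contraL fij => /eqP->; rewrite ltnn.
by case: eqP => _; rewrite ?addr0 //; ring.
Qed.

Lemma lower_Elocal f v w : lower f v w ->
  exists2 A, Elocal (ranked f) A & w = v *m A.
Proof.
have [N] := ubnP #|[pred k | w 0 k != v 0 k]|.
elim: N w => // N IHN w; rewrite ltnS => wN vw.
have [j0 j0P|same] := pickP [pred k | w 0 k != v 0 k]; last first.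
  exists 1%:M; first exact: subgroup_gen1.
  by apply/rowP => k; rewrite mulmx1; apply/eqP/negbFE; exact: same.
(* The changed coordinate of least rank is reset: its change involves only
   coordinates in which [v] and [w] agree. *)
case: (arg_minnP f j0P) => j /= wj jmin {j0 j0P}.
pose w' : 'rV[R]_n := \row_k if k == j then v 0 j else w 0 k.
have [||A EA w'E] := IHN w'.
- apply: leq_trans wN; apply: proper_card; apply/properP; split.
    apply/fintype.subsetP => k; rewrite !inE mxE; case: (k =P j) => // ->.
    by rewrite eqxx.
  by exists j; rewrite !inE // mxE !eqxx.
- move=> k; rewrite mxE; case: eqP => [->|_]; last exact: vw.
  by rewrite subrr; exact: low0.
have [c cE] := vw j.
have [|B EB w'B] := @Elocal_add_sum f w' j c [seq i <- index_enum 'I_n | (f i < f j)%N].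
  by move=> i; rewrite mem_filter => /andP[].
exists (A *m B); first exact: subgroup_gen_mul EA EB.
rewrite mulmxA -w'E w'B; apply/rowP => k; rewrite !mxE big_filter.
case: (eqVneq k j) => [->|_]; last by rewrite addr0.
rewrite -[LHS](subrK (v 0 j)) cE addrC; congr (_ + _).
apply: eq_bigr => i fij; congr (_ * _); rewrite mxE.
have /negPf-> : i != j by apply: contraL fij => /eqP->; rewrite ltnn.
by apply/eqP; rewrite eq_sym; apply: contraLR fij => wi; rewrite -leqNgt jmin.
Qed.

Lemma EUm_lower f v w : EUm_set v -> lower f v w -> EUm_set w.
Proof.
move=> Ev /lower_Elocal[A EA ->]; apply: EUm_mul EA => //.
exact: nilpotent_ranked.
Qed.

Lemma frame_lower f v w1 w2 w3 : EUm_set v ->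
  lower f v w1 -> lower f v w2 -> lower f v w3 ->
  frame [set row_point w1; row_point w2; row_point w3].
Proof.
move=> Ev /lower_Elocal[A1 EA1 ->] /lower_Elocal[A2 EA2 ->] /lower_Elocal[A3 EA3 ->].
exact: frame_Elocal (nilpotent_ranked f) Ev EA1 EA2 EA3.
Qed.

(** If [A] sends the base row to [v], then [v] times the column [o] of the
    inverse of [A] is 1. *)
Lemma EUm_unimodular v (o : 'I_n) : o = 0%N :> nat -> EUm_set v ->
  unimodular predT (v 0).
Proof.
move=> o0 [A EA <-]; have [B [AB _]] : GL A.
  apply: EA; split; first exact: GL_subgroup.
  by move=> _ [i [j [r [ij ->]]]]; exact: elem_GL.
exists (fun k => B k o).
have : (e1 R n *m A *m B) 0 o = 1 by rewrite -mulmxA AB mulmx1 mxE o0.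
by rewrite mxE => <-; apply: eq_bigr => k _; rewrite mulrC.
Qed.

End LocalOrbits.

(** * A section over the rows with a unimodular tail *)

Section UnimodularRows.
Variables (R : comPzRingType) (n : nat).
Implicit Types (f : 'I_n -> nat) (u v w x : 'rV[R]_n) (i j k : 'I_n).
Implicit Types (r s t : 'I_n -> R) (a : R).

Variables (o i0 : 'I_n).
Hypotheses (o0 : o = 0%N :> nat) (i0o : i0 != o).

(** Stable range is applied to the tail without one of its coordinates [j]; the
    last entry of the row to be shortened is not always a coordinate. *)
Definition core j : pred 'I_n := [pred k | (k != o) && (k != j)].

Hypothesis shorten : forall j (g c : 'I_n -> R) (p q : R), j != o ->
  \sum_(k | core j k) c k * g k + q * p = 1 ->
  exists t, unimodular (core j) (fun k => g k + t k * p).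

Local Notation tail := (predC1 o).
Local Notation base_class := (class (EUm_base R n) [::]).

(** If [t i = 0], this is the action of a product of elementary matrices with
    row index [i]. *)
Definition shear i t v : 'rV[R]_n := \row_k (v 0 k + t k * v 0 i).

Definition single j a : 'I_n -> R := fun k => if k == j then a else 0.

Definition tail_good v : Prop := EUm_set v /\ unimodular tail (v 0).

Definition first_one v : 'rV[R]_n := \row_k (if k == o then 1 else v 0 k).

(** The canonical path from the base row to [v]. Its two steps are edges if the
    tail of [v] is unimodular. *)
Definition tail_lift v : edge_class (EUm_base R n) :=
  class_step (class_step base_class (row_point (first_one v))) (row_point v).

(** Lifting the edge from [v] to [w] at the canonical lift of [v] leads to the
    canonical lift of [w]. *)
Definition compat v w : Prop :=
  class_step (tail_lift v) (row_point w) = tail_lift w.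

Lemma row_point_e1 : row_point (e1 R n) = EUm_base R n.
Proof. exact: (row_point_sval (EUm_base R n)). Qed.

Lemma tail_lift_end v : class_end (tail_lift v) = row_point v.
Proof. exact: class_end_step. Qed.

Lemma EUm_e1 : EUm_set (e1 R n).
Proof. exact: e1_EUm. Qed.

Lemma lower_e1_first_one v : lower (fun k => (k != o) : nat) (e1 R n) (first_one v).
Proof.
move=> k; rewrite !mxE; case: (eqVneq k o) => [->|ko].
  by rewrite o0 subrr; exact: low0.
have -> : v 0 k - (k == 0%N :> nat)%:R = v 0 k * e1 R n 0 o.
  rewrite mxE o0 mulr1 (_ : (k == 0%N :> nat) = false) ?subr0 //.
  by apply: contraNF ko => k0; apply/eqP/val_inj; rewrite /= o0; apply/eqP.
by apply: lowM; rewrite eqxx ko.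
Qed.

Lemma compat_sym f x v w : EUm_set x -> lower f x v -> lower f x w ->
  compat v w -> compat w v.
Proof.
move=> Ex xv xw vw; rewrite /compat -vw class_step_step.
  by rewrite -(tail_lift_end v) class_step_end.
by rewrite tail_lift_end; exact: (frame_lower Ex xv xw xv).
Qed.

Lemma compat_trans f x v w u : EUm_set x ->
  lower f x v -> lower f x w -> lower f x u ->
  compat v w -> compat w u -> compat v u.
Proof.
move=> Ex xv xw xu vw wu; rewrite /compat -wu -vw class_step_step //.
by rewrite tail_lift_end; exact: (frame_lower Ex xv xw xu).
Qed.

(** The edge from [v] to [w] is compared with the edge from [first_one v] to
    [first_one w] inside one local orbit; the latter edge forms a triangle with
    the base row. *)
Lemma compat_square f x v w : EUm_set x -> lower f x v -> lower f x w ->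
  lower f x (first_one v) -> lower f x (first_one w) -> compat v w.
Proof.
move=> Ex xv xw xv1 xw1; rewrite /compat /tail_lift.
have E1 : class_step (class_step base_class (row_point (first_one v)))
    (row_point (first_one w)) = class_step base_class (row_point (first_one w)).
  apply: class_step_step; rewrite class_endE /= -row_point_e1.
  exact: (frame_lower EUm_e1 (lower_refl _ _) (lower_e1_first_one v)
    (lower_e1_first_one w)).
rewrite -E1.
transitivity (class_step (class_step base_class (row_point (first_one v)))
  (row_point w)).
  by apply: class_step_step; rewrite class_end_step; exact: (frame_lower Ex xv1 xv xw).
symmetry; apply: class_step_step; rewrite class_end_step.
exact: (frame_lower Ex xv1 xw1 xw).
Qed.

Lemma compat_first v w : tail_good v -> (forall k, k != o -> w 0 k = v 0 k) ->
  compat v w.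
Proof.
move=> [Ev uv] wv; pose f k : nat := k == o.
have H u : (forall k, k != o -> u 0 k = v 0 k) -> lower f v u.
  move=> uE k; case: (eqVneq k o) => [->|ko].
    by apply: low_unimodular uv _ => i /= /negPf io; rewrite /f io eqxx.
  by rewrite uE // subrr; exact: low0.
apply: (compat_square Ev (H v _) (H w _) (H _ _) (H _ _)) => // k ko.
  by rewrite mxE (negPf ko).
by rewrite mxE (negPf ko) wv.
Qed.

Lemma lower_shear f i t v : (forall k, t k = 0 \/ (f i < f k)%N) ->
  lower f v (shear i t v).
Proof.
move=> tf k; rewrite mxE addrC addKr; case: (tf k) => [->|fik].
  by rewrite mul0r; exact: low0.
exact: lowM.
Qed.

Lemma tail_good_shear i t v : i != o -> t o = 0 -> t i = 0 -> tail_good v ->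
  tail_good (shear i t v).
Proof.
move=> io to ti [Ev /unimodularP uv]; split.
  apply: (EUm_lower Ev); apply: (@lower_shear (fun k => (k != i) : nat)) => k.
  by case: (eqVneq k i) => [->|_]; [left|right; rewrite eqxx].
apply/unimodularP => m; have [k ko vk] := uv m.
have [_ mD mM] := max_ideal m.
have [vi|vi] := pselect (sval m (v 0 i)); last first.
  by exists i => //; rewrite mxE ti mul0r addr0.
exists k => //; rewrite mxE => wk; apply: vk.
have -> : v 0 k = (v 0 k + t k * v 0 i) + - t k * v 0 i by ring.
by apply: mD wk _; exact: mM.
Qed.

(** Here the tail is ranked below [o], and inside the tail the coordinate [i]
    comes first: this allows both the operation itself and the change of [v o]
    into 1. *)
Lemma compat_shear i t v : i != o -> t o = 0 -> t i = 0 -> tail_good v ->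
  compat v (shear i t v).
Proof.
move=> io to ti [Ev uv].
pose f k : nat := if k == i then 0 else if k == o then 2 else 1.
have fi k : k != i -> (f i < f k)%N by rewrite /f eqxx => /negPf->; case: ifP.
have fo k : k != o -> (f k < f o)%N.
  by rewrite /f eqxx (eq_sym o) (negPf io) => /negPf->; case: ifP.
have H u : lower f v u -> lower f v (first_one u).
  move=> vu k; case: (eqVneq k o) => [->|ko]; last by rewrite mxE (negPf ko).
  by apply: low_unimodular uv _ => l; exact: fo.
have vw : lower f v (shear i t v).
  by apply: lower_shear => k; case: (eqVneq k i) => [->|/fi]; [left|right].
exact: compat_square Ev (lower_refl _ _) vw (H _ (lower_refl _ _)) (H _ vw).
Qed.

(** The ranking is: the core, then [o], then [j]. Since the core is unimodular,
    it suffices for changing [v o] into 1. *)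
Lemma compat_core j a v : j != o -> EUm_set v -> unimodular (core j) (v 0) ->
  compat v (shear o (single j a) v).
Proof.
move=> jo Ev uv; pose f k : nat := if k == o then 1 else if k == j then 2 else 0.
have H u : (forall k, core j k -> u 0 k = v 0 k) ->
    low f v j (u 0 j - v 0 j) -> lower f v u.
  move=> uE uj k; case: (eqVneq k o) => [->|ko].
    apply: low_unimodular uv _ => l /andP[/negPf lo /negPf lj].
    by rewrite /f lo lj eqxx.
  case: (eqVneq k j) => [->//|kj].
  by rewrite uE ?subrr /core /= ?ko //; exact: low0.
have fj : (f o < f j)%N by rewrite /f eqxx (negPf jo) eqxx.
have lj : low f v j (shear o (single j a) v 0 j - v 0 j).
  by rewrite mxE /single eqxx addrC addKr; exact: lowM.
have E k : core j k -> shear o (single j a) v 0 k = v 0 k.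
  by move=> /andP[_ /negPf kj]; rewrite mxE /single kj mul0r addr0.
apply: (@compat_square f v _ _ Ev); first exact: lower_refl.
- exact: H.
- apply: H => [k /andP[/negPf ko _]|]; first by rewrite mxE ko.
  by rewrite mxE (negPf jo) subrr; exact: low0.
- apply: H => [k kc|]; last by rewrite mxE (negPf jo).
  by rewrite mxE E //; case/andP: kc => /negPf->.
Qed.

(** With the coordinates ordered as [o], [i], then the others, one may add
    multiples of [o] to the tail and multiples of [i] to the rest of it. *)
Definition rank_first i k : nat := if k == o then 0 else if k == i then 1 else 2.

Lemma rank_first_o i k : k != o -> (rank_first i o < rank_first i k)%N.
Proof. by rewrite /rank_first eqxx => /negPf->; case: ifP. Qed.

Lemma rank_first_i i k : i != o -> k != o -> k != i ->
  (rank_first i i < rank_first i k)%N.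
Proof. by rewrite /rank_first eqxx => /negPf-> /negPf-> /negPf->. Qed.

Lemma lower_rank_first i v w (a b : 'I_n -> R) : i != o ->
  a o = 0 -> b o = 0 -> b i = 0 ->
  (forall k, w 0 k = v 0 k + a k * v 0 o + b k * v 0 i) ->
  lower (rank_first i) v w.
Proof.
move=> io ao bo bi wE k; rewrite wE.
have -> : v 0 k + a k * v 0 o + b k * v 0 i - v 0 k = a k * v 0 o + b k * v 0 i by ring.
case: (eqVneq k o) => [->|ko]; first by rewrite ao bo !mul0r addr0; exact: low0.
apply: lowD; first by apply: lowM; exact: rank_first_o.
case: (eqVneq k i) => [->|ki]; first by rewrite bi mul0r; exact: low0.
by apply: lowM; exact: rank_first_i.
Qed.

Definition on_core j t : 'I_n -> R := fun k => if core j k then t k else 0.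

Lemma on_core_o j t : on_core j t o = 0.
Proof. by rewrite /on_core /core /= eqxx. Qed.

Lemma on_core_j j t : on_core j t j = 0.
Proof. by rewrite /on_core /core /= eqxx andbF. Qed.

Lemma on_coreE j t k : core j k -> on_core j t k = t k.
Proof. by rewrite /on_core => ->. Qed.

Lemma core_cases j k : [\/ k = o, k = j | core j k].
Proof.
rewrite /core /=; case: (eqVneq k o) => [->|ko]; first by constructor 1.
by case: (eqVneq k j) => [->|kj]; [constructor 2|constructor 3].
Qed.

Lemma unimodular_eq (D : pred 'I_n) (g h : 'I_n -> R) :
  (forall k, D k -> g k = h k) -> unimodular D g -> unimodular D h.
Proof.
by move=> gh [c cE]; exists c; rewrite -cE; apply: eq_bigr => k /gh->.
Qed.

Lemma core_tail j (g : 'I_n -> R) : unimodular (core j) g -> unimodular tail g.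
Proof.
move=> /unimodularP ug; apply/unimodularP => m; have [k kc gk] := ug m.
by exists k => //; case/andP: kc.
Qed.

(** Modulo the core, the entries [j] of both rows are units, hence so is their
    product. Adding multiples of this product to the core makes the core
    unimodular. Since the product is a multiple of the entry [j] of either row,
    this is an operation inside the tail for both of them. *)
Lemma compat_single j a v : j != o -> tail_good v ->
  tail_good (shear o (single j a) v) ->
  compat v (shear o (single j a) v).
Proof.
move=> jo gv; set w := shear o _ v => gw; have oj : o != j by rewrite eq_sym.
have [Ev [c cE]] := gv; have [Ew [c' c'E]] := gw.
have wj : w 0 j = v 0 j + a * v 0 o by rewrite mxE /single eqxx.
have wk k : k != j -> w 0 k = v 0 k.
  by move=> /negPf kj; rewrite mxE /single kj mul0r addr0.
rewrite (bigD1 j) //= in cE; rewrite (bigD1 j) //= in c'E.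
(* The relation for [v] is multiplied by the one for [w]. *)
have [|t ut] := @shorten j (v 0) (fun k => c j * v 0 j * c' k + c k)
    (v 0 j * w 0 j) (c j * c' j) jo.
  under eq_bigr do rewrite mulrDl -mulrA.
  rewrite big_split /= -mulr_sumr.
  have wE : \sum_(k | (k != o) && (k != j)) c' k * w 0 k =
      \sum_(k | (k != o) && (k != j)) c' k * v 0 k.
    by apply: eq_bigr => k /andP[_ kj]; rewrite wk.
  move: cE c'E; rewrite wE.
  set S := \sum_(k | _) c k * _; set S' := \sum_(k | _) c' k * _ => cE c'E.
  have -> : S = 1 - c j * v 0 j by rewrite -cE; ring.
  have -> : S' = 1 - c' j * w 0 j by rewrite -c'E; ring.
  ring.
pose v2 := shear j (fun k => on_core j t k * w 0 j) v.
pose w2 := shear j (fun k => on_core j t k * v 0 j) w.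
have gv2 : tail_good v2 by apply: tail_good_shear; rewrite ?on_core_o ?on_core_j ?mul0r.
have vv2 : compat v v2 by apply: compat_shear; rewrite ?on_core_o ?on_core_j ?mul0r.
have ww2 : compat w w2 by apply: compat_shear; rewrite ?on_core_o ?on_core_j ?mul0r.
have v2w2 : compat v2 w2.
  have -> : w2 = shear o (single j a) v2.
    apply/rowP => k; rewrite !mxE /single on_core_o.
    case: (core_cases j k) => [->|->|kc].
    - by rewrite on_core_o (negPf oj); ring.
    - by rewrite on_core_j !eqxx; ring.
    - by case/andP: (kc) => _ /negPf kj; rewrite kj eqxx; ring.
  apply: compat_core => //; first by case: gv2.
  apply: unimodular_eq ut => k kc; rewrite !mxE on_coreE //; ring.
have lw : lower (rank_first j) v w.
  apply: (@lower_rank_first j _ _ (single j a) (fun=> 0)) => //.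
    by rewrite /single (negPf oj).
  by move=> k; rewrite mxE; ring.
have lv2 : lower (rank_first j) v v2.
  apply: (@lower_rank_first j _ _ (fun=> 0) (fun k => on_core j t k * w 0 j)) => //.
  - by rewrite on_core_o mul0r.
  - by rewrite on_core_j mul0r.
  - by move=> k; rewrite mxE; ring.
have lw2 : lower (rank_first j) v w2.
  apply: (@lower_rank_first j _ _ (single j a) (fun k => on_core j t k * w 0 j)) => //.
  - by rewrite /single (negPf oj).
  - by rewrite on_core_o mul0r.
  - by rewrite on_core_j mul0r.
  - by move=> k; rewrite mxE wj [w 0 k]mxE; ring.
have lv := lower_refl (rank_first j) v.
have w2w := compat_sym Ev lw lw2 ww2.
apply: (compat_trans Ev lv lv2 lw vv2).
exact: (compat_trans Ev lv2 lw2 lw v2w2 w2w).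
Qed.

(** A change of basis in the tail conjugates the operations which add multiples
    of the coordinate [o] to the tail. *)
Lemma compat_conj i r t v : i != o -> r o = 0 -> r i = 0 -> t o = 0 ->
  tail_good v -> tail_good (shear o t v) ->
  compat (shear i r v) (shear i r (shear o t v)) -> compat v (shear o t v).
Proof.
move=> io ro ri to gv gw c; have [Ev _] := gv; set w := shear o t v.
have lv := lower_refl (rank_first i) v.
have lw : lower (rank_first i) v w.
  apply: (@lower_rank_first i _ _ t (fun=> 0)) => // k; rewrite mxE; ring.
have lv2 : lower (rank_first i) v (shear i r v).
  apply: (@lower_rank_first i _ _ (fun=> 0) r) => // k; rewrite mxE; ring.
have lw2 : lower (rank_first i) v (shear i r w).
  apply: (@lower_rank_first i _ _ (fun k => t k + r k * t i) r) => //.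
    by rewrite to ro; ring.
  move=> k; rewrite !mxE; ring.
apply: (compat_trans Ev lv lv2 lw); first exact: compat_shear.
apply: (compat_trans Ev lv2 lw2 lw c); apply: (compat_sym Ev lw lw2).
exact: compat_shear.
Qed.

(** As the core is unimodular, the entry [j] may be changed freely, and a first
    step along it leaves an operation whose coefficient at [j] is 1. A change of
    basis in the tail then clears the other coefficients. *)
Lemma compat_shear_first_core j t v : j != o -> t o = 0 -> tail_good v ->
  unimodular (core j) (v 0) -> tail_good (shear o t v) -> compat v (shear o t v).
Proof.
move=> jo to gv uv gw; have [Ev _] := gv; have oj : o != j by rewrite eq_sym.
pose u := shear o (single j (t j - 1)) v.
pose t1 k := if k == j then 1 else t k.
have t1o : t1 o = 0 by rewrite /t1 (negPf oj).
have uE : shear o t1 u = shear o t v.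
  apply/rowP => k; rewrite !mxE /single /t1 (negPf oj).
  by case: (eqVneq k j) => [->|_]; ring.
have lu s : s o = 0 -> lower (fun k => (k != o) : nat) v (shear o s v).
  move=> so; apply: lower_shear => k.
  by case: (eqVneq k o) => [->|_]; [left|right; rewrite eqxx].
have ato : single j (t j - 1) o = 0 by rewrite /single (negPf oj).
have gu : tail_good u.
  split; first exact: EUm_lower Ev (lu _ ato).
  apply: (@core_tail j); apply: unimodular_eq uv => k /andP[_ /negPf kj].
  by rewrite mxE /single kj mul0r addr0.
apply: (compat_trans Ev (lower_refl _ v) (lu _ ato) (lu _ to)).
  exact: compat_core.
rewrite -uE; have gw1 : tail_good (shear o t1 u) by rewrite uE.
have ro := on_core_o j (fun k => - t k); have rj := on_core_j j (fun k => - t k).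
apply: (compat_conj jo ro rj) => //.
have E : shear j (on_core j (fun k => - t k)) (shear o t1 u) =
    shear o (single j 1) (shear j (on_core j (fun k => - t k)) u).
  apply/rowP => k; rewrite !mxE /t1 /single eqxx (negPf oj) on_core_o.
  case: (core_cases j k) => [->|->|kc].
  - by rewrite to on_core_o (negPf oj); ring.
  - by rewrite on_core_j eqxx; ring.
  - by case/andP: (kc) => _ /negPf kj; rewrite on_coreE // kj; ring.
rewrite E; apply: compat_single => //; first exact: tail_good_shear.
by rewrite -E; exact: tail_good_shear.
Qed.

(** By stable range, a change of basis in the tail makes the core
    unimodular. *)
Lemma compat_shear_first t v : t o = 0 -> tail_good v -> tail_good (shear o t v) ->
  compat v (shear o t v).
Proof.
move=> to gv gw; have [Ev [c cE]] := gv.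
have [|r ur] := @shorten i0 (v 0) c (v 0 i0) (c i0) i0o.
  by rewrite -cE [RHS](bigD1 i0) //= addrC.
have ro := on_core_o i0 r; have ri := on_core_j i0 r.
apply: (compat_conj i0o ro ri to gv gw).
pose t' k := t k + on_core i0 r k * t i0.
have E : shear i0 (on_core i0 r) (shear o t v) = shear o t' (shear i0 (on_core i0 r) v).
  by apply/rowP => k; rewrite !mxE /t' ro; ring.
have gw' : tail_good (shear i0 (on_core i0 r) (shear o t v)) by exact: tail_good_shear.
rewrite E in gw' *; apply: (@compat_shear_first_core i0) => //.
- by rewrite /t' to ro; ring.
- exact: tail_good_shear.
- by apply: unimodular_eq ur => k kc; rewrite mxE on_coreE.
Qed.

Lemma EUm_shear_first t v : t o = 0 -> EUm_set v -> EUm_set (shear o t v).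
Proof.
move=> to Ev; apply: (EUm_lower Ev).
apply: (@lower_shear (fun k => (k != o) : nat)) => k.
by case: (eqVneq k o) => [->|_]; [left|right; rewrite eqxx].
Qed.

(** Stable range is applied to the core followed by the combination of [v o]
    and [v i] in a relation of unimodularity. Since [v i] belongs to the tail,
    its part of the combination may be dropped, so that only multiples of [v o]
    are added, and the coordinate [i] is left alone. *)
Lemma tail_good_shear_first i v : i != o -> EUm_set v ->
  exists t, tail_good (shear o (on_core i t) v).
Proof.
move=> io Ev; have [c cE] := EUm_unimodular o0 Ev.
rewrite (bigD1 o) //= (bigD1 i) //= in cE.
have [|t /unimodularP ut] := @shorten i (v 0) c (c o * v 0 o + c i * v 0 i) 1 io.
  by rewrite mul1r -cE [RHS]addrA [RHS]addrC.
exists (fun k => t k * c o); split.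
  by apply: EUm_shear_first => //; exact: on_core_o.
apply/unimodularP => m; have [k kc vk] := ut m.
have [_ mD mM] := max_ideal m.
have [vi|vi] := pselect (sval m (v 0 i)); last first.
  by exists i => //; rewrite mxE on_core_j mul0r addr0.
exists k; [by case/andP: kc|rewrite mxE on_coreE // => uk; apply: vk].
have -> : v 0 k + t k * (c o * v 0 o + c i * v 0 i) =
  (v 0 k + t k * c o * v 0 o) + t k * c i * v 0 i by ring.
by apply: mD uk _; exact: mM.
Qed.

(** * Extension of the section to all rows *)

Lemma shear_first_comp s t v : s o = 0 -> t o = 0 ->
  shear o s (shear o t v) = shear o (fun k => s k + t k) v.
Proof. by move=> so to; apply/rowP => k; rewrite !mxE to; ring. Qed.

Lemma lower_shear_first t v : t o = 0 ->
  lower (fun k => (k != o) : nat) v (shear o t v).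
Proof.
move=> to; apply: lower_shear => k.
by case: (eqVneq k o) => [->|_]; [left|right; rewrite eqxx].
Qed.

Definition section_row v : edge_class (EUm_base R n) :=
  if pselect (exists t, t o = 0 /\ tail_good (shear o t v)) is left h
  then class_step (tail_lift (shear o (sval (cid h)) v)) (row_point v) else base_class.

Lemma section_rowE t v : EUm_set v -> t o = 0 -> tail_good (shear o t v) ->
  section_row v = class_step (tail_lift (shear o t v)) (row_point v).
Proof.
move=> Ev to gt; rewrite /section_row; case: pselect => [h|[]]; last by exists t.
case: (cid h) => s /= [so gs] {h}.
have E : shear o t v = shear o (fun k => t k - s k) (shear o s v).
  rewrite shear_first_comp ?to ?so ?subr0 //; congr shear.
  by apply/funext => k; rewrite subrK.
have c : compat (shear o s v) (shear o t v).
  by rewrite E; apply: compat_shear_first; rewrite -?E // to so subr0.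
rewrite -c class_step_step // tail_lift_end.
apply: (frame_lower Ev (lower_shear_first _ so) (lower_shear_first _ to)).
exact: lower_refl.
Qed.

(** The tail of the base row vanishes, so its section is computed along a
    detour, which is contained in one local orbit. *)
Lemma section_row_base : section_row (e1 R n) = base_class.
Proof.
pose t := single i0 1; have to : t o = 0 by rewrite /t /single eq_sym (negPf i0o).
have ge : tail_good (shear o t (e1 R n)).
  split; first exact: EUm_shear_first EUm_e1.
  exists (single i0 1); rewrite (bigD1 i0) //= big1 => [|k /andP[_ /negPf ki]].
    rewrite !mxE /t /single eqxx o0 eqxx (_ : (i0 == 0%N :> nat) = false).
      by rewrite /= !mul1r add0r addr0.
    by apply: contraNF i0o => /eqP i00; apply/eqP/val_inj; rewrite /= o0.
  by rewrite /single ki mul0r.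
rewrite (section_rowE EUm_e1 to ge).
have fixE : first_one (shear o t (e1 R n)) = shear o t (e1 R n).
  apply/rowP => k; rewrite !mxE; case: (eqVneq k o) => [->|//].
  by rewrite to o0 mul0r addr0.
have fr (v : EUm R n) :
  frame [set row_point (e1 R n); row_point (shear o t (e1 R n)); v] ->
  frame [set class_end base_class; row_point (shear o t (e1 R n)); v].
  by rewrite class_endE /= row_point_e1.
have le := lower_refl (fun k => (k != o) : nat) (e1 R n).
have lt := lower_shear_first (e1 R n) to.
rewrite /tail_lift fixE (class_step_step (fr _ (frame_lower EUm_e1 le lt lt))).
rewrite (class_step_step (fr _ (frame_lower EUm_e1 le lt le))).
by rewrite row_point_e1 -{2}(class_step_end base_class) class_endE.
Qed.

(** Let [u] be a row with unimodular tail which defines the section at [v]. If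
    [i] is [o], then [u] also serves for the new row. If [i] and [j] are in the
    tail, then applying the operation to [u] gives a row that serves for the new
    one. If [j] is [o], then [u] is chosen with the entry [i] of [v]. The entry
    [o] of [u] is changed in the same way as that of [v], and then the effect of
    this change on the multiples of the entry [o] added to the core is
    corrected by multiples of the entry [i]. *)
Lemma section_row_elem v i j a : EUm_set v -> i != j ->
  class_step (section_row v) (row_point (shear i (single j a) v)) =
  section_row (shear i (single j a) v).
Proof.
move=> Ev ij; set w := shear i (single j a) v.
have ati : single j a i = 0 by rewrite /single (negPf ij).
have Ew : EUm_set w.
  apply: (EUm_lower Ev); apply: (@lower_shear (fun k => (k != i) : nat)) => k.
  by case: (eqVneq k i) => [->|_]; [left|right; rewrite eqxx].
case: (eqVneq i o) => [io|io].
  have [t gt] := tail_good_shear_first i0o Ev; have to := on_core_o i0 t.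
  rewrite (section_rowE Ev to gt); move: (on_core i0 t) to gt => {}t to gt.
  pose s k := t k - single j a k.
  have so : s o = 0 by rewrite /s to -io ati subr0.
  have sE : shear o s w = shear o t v.
    rewrite /w io shear_first_comp //; last by rewrite -io.
    by congr shear; apply/funext => k; rewrite /s subrK.
  rewrite (section_rowE Ew so) sE //; apply: class_step_step; rewrite tail_lift_end.
  apply: (frame_lower Ev (lower_shear_first _ to) (lower_refl _ _)).
  by rewrite /w io; apply: lower_shear_first; rewrite -io.
have [t gt] := tail_good_shear_first io Ev.
have to := on_core_o i t; have ti := on_core_j i t.
rewrite (section_rowE Ev to gt); move: (on_core i t) to ti gt => {}t to ti gt.
case: (eqVneq j o) => [jo|jo]; last first.
  pose t' k := t k + single j a k * t i.
  have t'o : t' o = 0 by rewrite /t' /single to eq_sym (negPf jo); ring.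
  have ato : single j a o = 0 by rewrite /single eq_sym (negPf jo).
  have t'E : shear o t' w = shear i (single j a) (shear o t v).
    by apply/rowP => k; rewrite !mxE /t' ato; ring.
  have c : compat (shear o t v) (shear o t' w) by rewrite t'E; exact: compat_shear.
  have gt' : tail_good (shear o t' w) by rewrite t'E; exact: tail_good_shear.
  rewrite (section_rowE Ew t'o gt') -c.
  have lt : lower (rank_first i) v (shear o t v).
    by apply: (@lower_rank_first i _ _ t (fun=> 0)) => // k; rewrite mxE; ring.
  have lw : lower (rank_first i) v w.
    apply: (@lower_rank_first i _ _ (fun=> 0) (single j a)) => // k.
    by rewrite mxE; ring.
  have lt' : lower (rank_first i) v (shear o t' w).
    apply: (@lower_rank_first i _ _ t' (single j a)) => // k.
    by rewrite !mxE ato; ring.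
  transitivity (class_step (tail_lift (shear o t v)) (row_point w)).
    apply: class_step_step; rewrite tail_lift_end.
    exact: (frame_lower Ev lt (lower_refl _ _) lw).
  symmetry; apply: class_step_step; rewrite tail_lift_end.
  exact: (frame_lower Ev lt lt' lw).
pose f k : nat := if k == i then 0 else if k == o then 1 else 2.
have oi : o != i by rewrite eq_sym.
have fo : (f i < f o)%N by rewrite /f !eqxx (negPf oi).
have fk k : k != i -> k != o -> (f o < f k)%N.
  by rewrite /f eqxx (negPf oi) => /negPf-> /negPf->.
have fi k : k != i -> (f i < f k)%N.
  by rewrite /f eqxx => /negPf->; case: ifP.
have lf u b : (forall k, u 0 k = v 0 k + t k * v 0 o + b k * v 0 i) -> b i = 0 ->
    lower f v u.
  move=> uE bi k; rewrite uE.
  have -> : v 0 k + t k * v 0 o + b k * v 0 i - v 0 k =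
    t k * v 0 o + b k * v 0 i by ring.
  apply: lowD.
    case: (eqVneq k i) => [->|ki]; first by rewrite ti mul0r; exact: low0.
    case: (eqVneq k o) => [->|ko]; first by rewrite to mul0r; exact: low0.
    by apply: lowM; exact: fk.
  case: (eqVneq k i) => [->|ki]; first by rewrite bi mul0r; exact: low0.
  by apply: lowM; exact: fi.
have lw : lower f v w.
  apply: lower_shear => k; case: (eqVneq k i) => [->|ki]; first by left.
  by right; exact: fi.
have lu : lower f v (shear o t v).
  by apply: (lf _ (fun=> 0)) => // k; rewrite mxE; ring.
(* The rows [shear o t v], [u2] and [shear o t w] have unimodular tails and
   lie in one local orbit with [v] and [w]. *)
pose u2 := shear i (single o a) (shear o t v).
have ato : single o a i = 0 by rewrite /single (negPf io).
have lu2 : lower f v u2.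
  by apply: (lf _ (single o a)) => // k; rewrite !mxE ti; ring.
have u2E k : k != o -> u2 0 k = shear o t v 0 k.
  by move=> /negPf ko; rewrite mxE /single ko mul0r addr0.
have gu2 : tail_good u2.
  split; first exact: EUm_lower Ev lu2.
  by apply: unimodular_eq (proj2 gt) => k ko; rewrite u2E.
have u3E : shear o t w = shear i (fun k => t k * a) u2.
  apply/rowP => k; rewrite /w jo !mxE ti ato /single eqxx; ring.
have gu3 : tail_good (shear o t w).
  by rewrite u3E; apply: tail_good_shear; rewrite ?to ?ti ?mul0r.
have lu3 : lower f v (shear o t w).
  apply: (lf _ (fun k => single j a k + t k * a)); last by rewrite ati ti mul0r addr0.
  by move=> k; rewrite /w jo !mxE /single eqxx; ring.
have c2 : compat (shear o t v) u2 by exact: compat_first.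
have c3 : compat u2 (shear o t w).
  by rewrite u3E; apply: compat_shear; rewrite ?to ?ti ?mul0r.
have c := compat_trans Ev lu lu2 lu3 c2 c3.
rewrite (section_rowE Ew to gu3) -c.
transitivity (class_step (tail_lift (shear o t v)) (row_point w)).
  apply: class_step_step; rewrite tail_lift_end.
  exact: (frame_lower Ev lu (lower_refl _ _) lw).
symmetry; apply: class_step_step; rewrite tail_lift_end.
exact: (frame_lower Ev lu lu3 lw).
Qed.

Lemma section_row_end v : EUm_set v -> class_end (section_row v) = row_point v.
Proof.
move=> Ev; have [t gt] := tail_good_shear_first i0o Ev.
by rewrite (section_rowE Ev (on_core_o i0 t) gt) class_end_step.
Qed.

Lemma section_row_Elocal alpha v A : nilpotent alpha -> EUm_set v ->
  Elocal alpha A ->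
  class_step (section_row v) (row_point (v *m A)) = section_row (v *m A).
Proof.
move=> na Ev EA; move: v Ev.
pose P := [set A | @Elocal R n alpha A /\ forall v, EUm_set v ->
  class_step (section_row v) (row_point (v *m A)) = section_row (v *m A)].
suff /(_ A EA)[] : @Elocal R n alpha `<=` P by [].
have I1 : @Elocal R n alpha 1%:M by exact: subgroup_gen1.
move=> {EA}A; apply; split.
  split=> [B [EB _]|||]; first exact: Elocal_GL EB.
  - split=> // v Ev; rewrite mulmx1.
    by rewrite -(section_row_end Ev) class_step_end.
  - move=> {}A B [EA PA] [EB PB].
    have EAB := subgroup_gen_mul EA EB; split=> // v Ev.
    have EvA := EUm_mul na Ev EA.
    rewrite mulmxA -PB // -PA // class_step_step // section_row_end //.
    rewrite -{1}[v]mulmx1 -mulmxA; exact: (frame_Elocal na Ev I1 EA EAB).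
  - move=> {}A B [EA PA] AB BA.
    have EB := subgroup_gen_inv EA AB BA; split=> // v Ev.
    have EvB := EUm_mul na Ev EB.
    have := PA _ EvB; rewrite -mulmxA BA mulmx1 => <-.
    rewrite class_step_step; last first.
      rewrite section_row_end // -{2}[v]mulmx1.
      exact: (frame_Elocal na Ev EB I1 EB).
    by rewrite -section_row_end // class_step_end.
move=> _ [i [j [r [ij ->]]]]; split; first by apply: subgroup_gen_in; exists i, j, r.
move=> v Ev; have [neq _ _] := na.
have -> : v *m elem i j r = shear i (single j r) v.
  apply/rowP => k; rewrite mulmx_elem mxE /single.
  by case: eqP => _; rewrite ?mul0r.
exact/section_row_elem/neq.
Qed.

Lemma section_row_frame (y z : EUm R n) : frame [set y; z] ->
  class_step (section_row (sval y)) z = section_row (sval z).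
Proof.
move=> [_ _ [alpha [x [na yz]]]].
have [A EA yE] : local_orbit alpha x y by apply: yz; left.
have [B EB zE] : local_orbit alpha x z by apply: yz; right.
have [A' [AA' A'A]] := Elocal_GL na EA.
have EA' := subgroup_gen_inv EA AA' A'A.
have -> : z = row_point (sval y *m (A' *m B)).
  by rewrite yE mulmxA -(mulmxA _ A) AA' mulmx1 -zE row_point_sval.
have EAB := subgroup_gen_mul EA' EB.
have Ey : EUm_set (sval y) := svalP y.
by rewrite (section_row_Elocal na Ey EAB) row_point_val //; exact: EUm_mul EAB.
Qed.

Lemma pi1_EUm_trivial (u : pi1 (EUm_base R n)) : u = 1%g.
Proof.
exact: (@pi1_trivial_of_section (EUm R n) (EUm_base R n)
  (fun y => section_row (sval y)) section_row_base section_row_frame).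
Qed.

End UnimodularRows.

Theorem corollary5p4 (R : comPzRingType) (d n : nat)
  (noethR : noetherian_space (max_spec R))
  (dimR : krull_dim_le (max_spec R) d)
  (hn : (d + 3 <= n)%N) :
  forall u : pi1 (EUm_base R n), u = 1%g.
Proof.
have n0 : (0 < n)%N by lia.
have n1 : (1 < n)%N by lia.
pose o := Ordinal n0; pose i0 := Ordinal n1.
apply: (@pi1_EUm_trivial R n o i0) => //.
move=> j g c p q jo; apply: bass_stable_range noethR dimR _.
have : (#|[set o; j]%SET| + #|core o j| = n)%N.
  rewrite -[RHS]card_ord -(cardsC [set o; j]%SET); congr addn.
  by rewrite -[in RHS]cardsE; apply: eq_card => k; rewrite !inE negb_or.
rewrite cards2 eq_sym jo addnC -(leq_add2r 2) => ->; lia.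
Qed.
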